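(* Let $A=k[X]$ and $B=k[Y]$ be polynomial rings over a field $k$ in disjoint finite sets of variables, and let $R=A\otimes_k B=k[X,Y]$. Let $\{I_i\}_{i\ge0}$ and $\{J_j\}_{j\ge0}$ be filtrations of homogeneous ideals in $A$ and $B$, respectively, and let $Q_n=\sum_{i+j=n}I_iJ_j$. Then for all $n\ge1$: (i) $$\operatorname{depth} R/Q_n\ge\min_{i\in[1,n-1],\ j\in[1,n]}\left\{\operatorname{depth} A/I_{n-i}+\operatorname{depth} B/J_i+1,\ \operatorname{depth} A/I_{n-j+1}+\operatorname{depth} B/J_j\right\};$$ (ii) $$\operatorname{reg} R/Q_n\le\max_{i\in[1,n-1],\ j\in[1,n]}\left\{\operatorname{reg} A/I_{n-i}+\operatorname{reg} B/J_i+1,\ \operatorname{reg} A/I_{n-j+1}+\operatorname{reg} B/J_j\right\}.$$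
   Context: Polynomial rings have the standard grading; $\operatorname{depth}$ is with respect to the maximal homogeneous ideal and $\operatorname{reg}$ is Castelnuovo-Mumford regularity. A filtration of ideals in a ring $S$ is a sequence $\{P_n\}_{n\ge0}$ of ideals such that $P_0=S$, $P_1$ is a nonzero proper ideal, and $P_n\supseteq P_{n+1}$ for all $n\ge0$. Ideals of $A$ and $B$ are identified with their extensions to $R$; the sum defining $Q_n$ is over integers $i,j\ge0$ with $i+j=n$. The minimum (resp. maximum) is taken over the set of all the numbers of the first form for integers $1\le i\le n-1$ together with all the numbers of the second form for integers $1\le j\le n$; for $n=1$ there are no terms of the first form. *)

(* Defs.v *)
(* The notations of mpoly must be loaded before those of constructive_ereal:
   loading them in the other order is an error. *)
From mathcomp Require Import all_boot all_order all_algebra.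
From mathcomp Require Import mpoly.
From mathcomp Require Import boolp classical_sets constructive_ereal.

Set Implicit Arguments.
Unset Strict Implicit.
Unset Printing Implicit Defensive.

Import Order.TTheory GRing.Theory Num.Theory.
Local Open Scope classical_set_scope.
Local Open Scope ring_scope.

(* MathComp's [ideal] predicates only cover decidable, proper ideals; here the
   unit ideal has to be allowed. *)
Record is_ideal (S : comNzRingType) (I : set S) : Prop := IsIdeal {
  is_ideal0 : I 0;
  is_idealD : forall x y, I x -> I y -> I (x + y);
  is_idealM : forall a x, I x -> I (a * x) }.

Definition ideal_span (S : comNzRingType) (E : set S) : set S :=
  [set y | exists s : seq (S * S),
     (forall z, z \in s -> E z.2) /\ y = \sum_(z <- s) z.1 * z.2].

Definition ideal_mul (S : comNzRingType) (I J : set S) : set S :=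
  ideal_span [set z | exists x y, [/\ I x, J y & z = x * y]].

Record filtration (S : comNzRingType) (P : nat -> set S) : Prop := Filtration {
  filtration_ideal : forall n, is_ideal (P n);
  filtration0 : P 0%N = setT;
  filtration1_neq0 : exists2 x, P 1%N x & x != 0;
  filtration1_proper : P 1%N <> setT;
  filtration_decr : forall n, P n.+1 `<=` P n }.

Definition homogeneous_ideal (k : fieldType) (n : nat)
    (I : set {mpoly k[n]}) : Prop :=
  forall p d, I p -> I (pihomog mdeg d p).

(* k[X] and k[Y], with r and s variables, sit inside k[X, Y] as the polynomials
   in the first r, resp. the last s, of its r + s variables. *)
Definition embX (k : fieldType) (r s : nat) (p : {mpoly k[r]}) :
    {mpoly k[r + s]} := p \mPo [tuple 'X_(lshift s i) | i < r].

Definition embY (k : fieldType) (r s : nat) (p : {mpoly k[s]}) :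
    {mpoly k[r + s]} := p \mPo [tuple 'X_(rshift r j) | j < s].

Definition sum_filtration (k : fieldType) (r s : nat)
    (I : nat -> set {mpoly k[r]}) (J : nat -> set {mpoly k[s]}) (n : nat) :
    set {mpoly k[r + s]} :=
  ideal_span [set p | exists i j, (i + j)%N = n /\
    ideal_mul (ideal_span (@embX k r s @` I i))
              (ideal_span (@embY k r s @` J j)) p].

(* [xs] is a regular sequence on S/I: each x is a nonzerodivisor modulo I and
   the elements before it, and I + (xs) is not S. *)
Fixpoint regular_sequence (S : comNzRingType) (I : set S) (xs : seq S) : Prop :=
  match xs with
  | [::] => I <> setT
  | x :: xs' => (forall p, I (x * p) -> I p) /\
      regular_sequence [set p | exists q, I (p - q * x)] xs'
  end.

(* The depth of k[x_1, ..., x_n]/I with respect to (x_1, ..., x_n): the supremum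
   of the lengths of the regular sequences in that maximal ideal.  The zero
   module (I = setT) has none, and its depth is +oo. *)
Definition depth (k : fieldType) (n : nat) (I : set {mpoly k[n]}) : \bar int :=
  supremum +oo%E [set ((size xs)%:Z)%:E | xs in
    [set xs : seq {mpoly k[n]} |
      (forall x, x \in xs -> x@_0%MM = 0) /\ regular_sequence I xs]].

(* Graded free resolutions ... -> F_1 -> F_0 -> k[x_1, ..., x_n]/I -> 0.
   F_i has a basis indexed by 'I_(gfr_rank i), whose u-th element has degree
   gfr_deg u.  Elements of F_i are row vectors and maps act on them by right
   multiplication; the u-th basis element of F_0 goes to the class of
   gfr_aug u 0.  The degree conditions say that all maps preserve degrees. *)
Record graded_free_resolution (k : fieldType) (n : nat)
    (I : set {mpoly k[n]}) := GradedFreeResolution {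
  gfr_rank : nat -> nat;
  gfr_deg : forall i, 'I_(gfr_rank i) -> int;
  gfr_aug : 'cV[{mpoly k[n]}]_(gfr_rank 0);
  gfr_diff : forall i, 'M[{mpoly k[n]}]_(gfr_rank i.+1, gfr_rank i);
  gfr_aug_deg : forall u m, m \in msupp (gfr_aug u 0) ->
    (mdeg m)%:Z = gfr_deg u;
  gfr_diff_deg : forall i u v m, m \in msupp (gfr_diff i u v) ->
    (mdeg m)%:Z + gfr_deg v = gfr_deg u;
  gfr_aug_surj : forall p, exists w : 'rV_(gfr_rank 0),
    I (p - (w *m gfr_aug) 0 0);
  gfr_exact0 : forall w : 'rV_(gfr_rank 0),
    I ((w *m gfr_aug) 0 0) <-> exists w', w = w' *m gfr_diff 0;
  gfr_exactS : forall i (w : 'rV_(gfr_rank i.+1)),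
    w *m gfr_diff i = 0 <-> exists w', w = w' *m gfr_diff i.+1 }.

(* The image of each F_(i+1) -> F_i lies in (x_1, ..., x_n) F_i. *)
Definition minimal_resolution (k : fieldType) (n : nat) (I : set {mpoly k[n]})
    (F : graded_free_resolution I) : Prop :=
  forall i u v, (gfr_diff F i u v)@_0%MM = 0.

(* The Castelnuovo-Mumford regularity of k[x_1, ..., x_n]/I: the supremum of
   j - i over the degrees j of the basis elements of F_i, for F a minimal graded
   free resolution (the ranks and degrees do not depend on the choice of F).
   For the zero module F = 0, and the regularity is -oo. *)
Definition reg (k : fieldType) (n : nat) (I : set {mpoly k[n]}) : \bar int :=
  supremum -oo%E [set x | exists (F : graded_free_resolution I) (i : nat)
    (u : 'I_(gfr_rank F i)),
    minimal_resolution F /\ x = (gfr_deg u - i%:Z)%:E].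

(* Main.v *)
Require Import Defs.
From HB Require Import structures.
From mathcomp Require Import all_boot all_order all_algebra.
From mathcomp Require Import mpoly.
From mathcomp Require Import boolp classical_sets constructive_ereal.
From mathcomp Require Import zify.

(* Put U_i = I_i R + Q_n, so that U_0 = R, U_n = Q_n and
   U_i / U_(i+1) = (I_i / I_(i+1)) (x)_k (B / J_(n-i)) for i < n.
   Depth and regularity are both read off from the bidegrees (p, z) in which
   the Koszul homology H_p(x_1, ..., x_n; M)_z = Tor_p(k, M)_z vanishes:
   depth M >= d iff it vanishes for p > n - d, and reg M <= a iff it vanishes
   for z - p > a.  The exact sequence
     0 -> I_i / I_(i+1) -> A / I_(i+1) -> A / I_i -> 0
   turns the vanishing for A / I_(i+1) and A / I_i into one for I_i / I_(i+1),
   a Kuenneth argument (dimension shifting along a minimal resolution of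
   B / J_(n-i)) into one for U_i / U_(i+1), and the filtration (U_i) into one
   for R / Q_n.  Working with these quotients instead of the products I_i J_j
   avoids all case distinctions on zero ideals. *)

Set Implicit Arguments.
Unset Strict Implicit.
Unset Printing Implicit Defensive.

Import Order.TTheory GRing.Theory Num.Theory.
Local Open Scope classical_set_scope.
Local Open Scope ring_scope.

(** * Koszul complexes *)

(** Layer i uses I_(i+1) with J_(n-i), which is the second form for j = n-i, and I_i with J_(n-i),
    which is the first form. The extra 1 comes from the connecting map H_(p+1)(A/I_i) ->
    H_p(I_i/I_(i+1)), which asks for vanishing one homological degree higher. For i = 0 the module
    A/I_0 is zero and asks for nothing: hence the range [1, n-1] of the first form. Depth is defined
    by regular sequences and regularity by minimal resolutions, so both need a translation. For
    depth, Koszul vanishing in top degree makes the socle zero, and prime avoidance then yields a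
    nonzerodivisor. For regularity, minimal resolutions must be shown to exist, since [reg] would
    otherwise be the supremum of an empty set. Both rest on Hilbert's basis theorem. No quotient
    module, tensor product or Tor is formed. A module is a pair of ideals Q inside P, and a homology
    class is represented by a chain with coefficients in P whose boundary has coefficients in Q.
    Flatness over k becomes a statement on finite sums of products of elements of A and B. *)

Section Grading.
Variables (k : fieldType) (n : nat).
Implicit Types (p q a : {mpoly k[n]}) (z : int).

(** Degrees are integers because the shifts by [p] and by degrees of basis elements can make them
    negative; the component is then 0. *)
Definition pih z p : {mpoly k[n]} :=
  if z is Posz d then pihomog mdeg d p else 0.

Definition ishom z p := forall m, m \in msupp p -> (mdeg m)%:Z = z.

Lemma mcoeff_pih z p m :
  (pih z p)@_m = if (mdeg m)%:Z == z then p@_m else 0.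
Proof.
rewrite /pih; case: z => d; last by rewrite mcoeff0.
rewrite pihomogE raddf_sum /= eqz_nat.
under eq_bigr do rewrite mcoeffZ mcoeffX.
have [pm|pm] := boolP (m \in msupp p); last first.
  rewrite big1_seq ?(memN_msupp_eq0 pm) ?if_same // => m' /andP[_ pm'].
  by case: eqP pm pm' => [->/negP //|]; rewrite mulr0.
case: eqP => [md|md]; last first.
  rewrite big1 // => m' /eqP m'd; case: eqP => [mm|]; last by rewrite mulr0.
  by case: md; rewrite -mm.
rewrite (big_rem m) //= md !eqxx mulr1 big1_seq ?addr0 // => m' /andP[_].
rewrite mem_rem_uniq ?msupp_uniq // inE => /andP[/negbTE-> _].
by rewrite mulr0.
Qed.

Lemma pih_is_zmod_morphism z : zmod_morphism (pih z).
Proof.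
by move=> p q; apply/mpolyP=> m; rewrite mcoeffB !mcoeff_pih mcoeffB; case: ifP => //;
  rewrite subr0.
Qed.

HB.instance Definition _ z :=
  GRing.isZmodMorphism.Build _ _ (pih z) (pih_is_zmod_morphism z).

Lemma pihP z p : ishom z (pih z p).
Proof.
move=> m; rewrite mcoeff_msupp mcoeff_pih.
by case: ifP => [/eqP //|_]; rewrite eqxx.
Qed.

Lemma pih_id z p : ishom z p -> pih z p = p.
Proof.
move=> pz; apply/mpolyP=> m; rewrite mcoeff_pih; case: ifP => // /negP mz.
apply/esym/eqP; rewrite mcoeff_eq0; apply/negP=> /pz mz'.
by apply: mz; rewrite mz'.
Qed.

Lemma ishom_pih z p : pih z p = p -> ishom z p.
Proof. by move<-; exact: pihP. Qed.

Lemma pihM z d a p : ishom d a -> pih z (a * p) = a * pih (z - d) p.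
Proof.
move=> ad; apply/mpolyP=> m; rewrite mcoeff_pih !mcoeffM.
case: ifP => mz.
  apply: eq_bigr => -[m1 m2] /=; move: (bmnm m1) (bmnm m2) =>
    {}m1 {}m2 /eqP /(congr1 (@mdeg n)); rewrite mdegD mcoeff_pih => mE.
  have [/ad dE|/memN_msupp_eq0->] := boolP (m1 \in msupp a); last by rewrite !mul0r.
  case: eqP => //; case; move/eqP: mz => <-; rewrite mE -dE.
  by rewrite PoszD addrAC subrr add0r.
apply/esym/big1 => -[m1 m2] /=; move: (bmnm m1) (bmnm m2) =>
  {}m1 {}m2 /eqP /(congr1 (@mdeg n)); rewrite mdegD mcoeff_pih => mE.
have [/ad dE|/memN_msupp_eq0->] := boolP (m1 \in msupp a); last by rewrite mul0r.
case: eqP => [m2E|]; last by rewrite mulr0.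
by case/eqP: mz; rewrite mE PoszD m2E dE addrC subrK.
Qed.

Lemma ishomX i : ishom 1 ('X_i : {mpoly k[n]}).
Proof. by move=> m; rewrite msuppX inE => /eqP ->; rewrite mdeg1. Qed.

Lemma ishom0 z : ishom z 0.
Proof. by move=> m; rewrite msupp0. Qed.

Lemma pihom_sum p : p = \sum_(d < msize p) pih d%:Z p.
Proof. exact: (pihomog_partitionE (leqnn (msize p))). Qed.

Lemma pih_pih z1 z2 p : pih z1 (pih z2 p) = if z1 == z2 then pih z2 p else 0.
Proof.
apply/mpolyP=> m; rewrite !mcoeff_pih.
case: (eqVneq z1 z2) => [->|ne].
  by rewrite mcoeff_pih; case: ((mdeg m)%:Z == z2).
rewrite mcoeff0; case: eqP => // mz1; case: eqP => // mz2.
by case/eqP: ne; rewrite -mz1.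
Qed.

End Grading.

Arguments pih : simpl never.

Section Koszul.
Variables (k : fieldType) (n : nat).
Local Notation R := {mpoly k[n]}.
Local Notation chain := {ffun {set 'I_n} -> {mpoly k[n]}}.
Implicit Types (c b : chain) (i : 'I_n) (T : {set 'I_n}).

(* A chain maps T to the coefficient of e_T in the Koszul complex; [con i] and
   [ext i] are the contraction with, and the exterior product by, e_i. *)
Definition ksign i T := #|[set j in T | (j < i)%N]%SET|.

Definition con i c : chain :=
  [ffun T : {set 'I_n} =>
     if i \in T then 0 else (-1) ^+ ksign i T * c (i |: T)%SET].

Definition ext i c : chain :=
  [ffun T : {set 'I_n} =>
     if i \in T then (-1) ^+ ksign i T * c (T :\ i)%SET else 0].

Definition cmap (f : R -> R) c : chain := [ffun T => f (c T)].

(** Named so that it can carry the additive structure that the lemmas on [cmap] ask for. *)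
Definition lmul (a x : R) : R := a * x.

Lemma lmul_is_zmod_morphism a : zmod_morphism (lmul a).
Proof. by move=> x y; rewrite /lmul mulrBr. Qed.
HB.instance Definition _ a :=
  GRing.isZmodMorphism.Build _ _ (lmul a) (lmul_is_zmod_morphism a).

Definition kd c : chain := \sum_i cmap (lmul 'X_i) (con i c).

Lemma ksignU i j T : j \notin T -> ksign i (j |: T)%SET = ((j < i) + ksign i T)%N.
Proof.
move=> jT; rewrite /ksign; have [ji|ij] := boolP (j < i)%N.
  have -> : [set l in j |: T | (l < i)%N]%SET = (j |: [set l in T | (l < i)%N])%SET.
    by apply/setP=> l; rewrite !inE andb_orl; case: eqP => // ->; rewrite ji.
  by rewrite cardsU1 inE (negbTE jT).
congr #|pred_of_set _|; apply/setP=> l; rewrite !inE andb_orl.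
by case: eqP => [->|_] /=; rewrite ?(negbTE ij) ?andbF.
Qed.

Lemma ksignD i j T : j \in T -> ksign i T = ((j < i) + ksign i (T :\ j)%SET)%N.
Proof. by move=> jT; rewrite -ksignU ?in_setD1 ?eqxx // finset.setD1K. Qed.

Lemma ksignD1 i T : ksign i (T :\ i)%SET = ksign i T.
Proof.
have [iT|iT] := boolP (i \in T); first by rewrite (ksignD i iT) ltnn.
by congr ksign; apply/setP=> l; rewrite !inE; case: eqP => [->|_] /=; rewrite ?(negbTE iT).
Qed.

Lemma conA i j c : con i (con j c) = - con j (con i c).
Proof.
apply/ffunP=> T; rewrite !ffunE !inE.
have [iT|iT] := boolP (i \in T).
  by rewrite orbT mulr0 if_same oppr0.
have [jT|jT] := boolP (j \in T); first by rewrite orbT mulr0 oppr0.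
rewrite !orbF (eq_sym j i); have [->|ij] := eqVneq i j; first by rewrite mulr0 oppr0.
rewrite !ksignU // finset.setUCA !mulrA -!exprD -mulNr -[- (_ ^+ _)]mulN1r -exprS.
(* Exactly one of i < j and j < i holds; this accounts for the minus sign. *)
congr (_ * _); rewrite -signr_odd -[RHS]signr_odd; congr (_ ^+ nat_of_bool _).
rewrite /= !oddD !oddb; move: ij; rewrite -val_eqE /=.
by case: ltngtP => //= _ _; case: (odd _); case: (odd _).
Qed.

Lemma con2 i c : con i (con i c) = 0.
Proof.
by apply/ffunP=> T; rewrite !ffunE !inE eqxx mulr0 if_same.
Qed.

Lemma con_ext i j c : i != j -> con i (ext j c) = - ext j (con i c).
Proof.
move=> ij; apply/ffunP=> T; rewrite !ffunE !inE eq_sym (negbTE ij) /=.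
have [iT|iT] := boolP (i \in T).
  by rewrite /= mulr0 if_same oppr0.
have [jT|jT] := boolP (j \in T); last by rewrite mulr0 oppr0.
have -> : ((i |: T) :\ j = i |: (T :\ j))%SET.
  by apply/setP=> l; rewrite !inE; case: (eqVneq l i) => [->|//]; rewrite ij.
rewrite (ksignU j iT) (ksignD i jT) !mulrA -!exprD -mulNr -[- (_ ^+ _)]mulN1r -exprS.
congr (_ * _); rewrite -signr_odd -[RHS]signr_odd; congr (_ ^+ nat_of_bool _).
rewrite /= !oddD !oddb; move: ij; rewrite -val_eqE /=.
by case: ltngtP => //= _ _; case: (odd _); case: (odd _).
Qed.

(** Together with [con_ext] these are the Clifford relations, the source of every contracting
    homotopy below. *)
Lemma con_ext_same i c : con i (ext i c) + ext i (con i c) = c.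
Proof.
apply/ffunP=> T; rewrite !ffunE !inE eqxx /=.
have [iT|iT] := boolP (i \in T).
  by rewrite add0r ksignD1 finset.setD1K // mulrA -exprD addnn -muln2 exprM sqrr_sign mul1r.
rewrite addr0 finset.setU1K // ksignU // ltnn mulrA -exprD addnn -muln2 exprM.
by rewrite sqrr_sign mul1r.
Qed.

Lemma cmap_con (f : {additive R -> R}) i c : cmap f (con i c) = con i (cmap f c).
Proof.
by apply/ffunP=> T; rewrite !ffunE; case: ifP; rewrite ?raddf0 ?raddfMsign.
Qed.

Lemma cmap_ext (f : {additive R -> R}) i c : cmap f (ext i c) = ext i (cmap f c).
Proof.
by apply/ffunP=> T; rewrite !ffunE; case: ifP; rewrite ?raddf0 ?raddfMsign.
Qed.

Lemma cmap_is_zmod_morphism (f : {additive R -> R}) : zmod_morphism (cmap f).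
Proof. by move=> c b; apply/ffunP=> T; rewrite !ffunE raddfB. Qed.
HB.instance Definition _ (f : {additive R -> R}) :=
  GRing.isZmodMorphism.Build _ _ (cmap f) (cmap_is_zmod_morphism f).

Lemma con_is_zmod_morphism i : zmod_morphism (con i).
Proof.
by move=> c b; apply/ffunP=> T; rewrite !ffunE; case: ifP => _; rewrite ?subr0 // mulrBr.
Qed.
HB.instance Definition _ i :=
  GRing.isZmodMorphism.Build _ _ (con i) (con_is_zmod_morphism i).

Lemma ext_is_zmod_morphism i : zmod_morphism (ext i).
Proof.
by move=> c b; apply/ffunP=> T; rewrite !ffunE; case: ifP => _; rewrite ?subr0 // mulrBr.
Qed.
HB.instance Definition _ i :=
  GRing.isZmodMorphism.Build _ _ (ext i) (ext_is_zmod_morphism i).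

Lemma kd_is_zmod_morphism : zmod_morphism kd.
Proof.
move=> c b; rewrite /kd -sumrB; apply: eq_bigr => i _.
by rewrite raddfB /= raddfB.
Qed.
HB.instance Definition _ :=
  GRing.isZmodMorphism.Build _ _ kd kd_is_zmod_morphism.

Lemma kdE c T : kd c T = \sum_i 'X_i * con i c T.
Proof. by rewrite /kd sum_ffunE; apply: eq_bigr => i _; rewrite ffunE. Qed.

Lemma kdd c : kd (kd c) = 0.
Proof.
have E : kd (kd c) = \sum_i \sum_j cmap (lmul ('X_i * 'X_j)) (con i (con j c)).
  rewrite {1}/kd; apply: eq_bigr => i _; rewrite /kd !raddf_sum /=.
  apply: eq_bigr => j _; rewrite -cmap_con.
  by apply/ffunP=> T; rewrite !ffunE /lmul mulrA.
(* The summand is antisymmetric and zero on the diagonal, so the terms with j < i cancel those with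
   i < j. *)
pose F i j := cmap (lmul ('X_i * 'X_j)) (con i (con j c)).
have FA i j : F i j = - F j i.
  by rewrite /F conA raddfN mulrC.
have F0 i : F i i = 0 by rewrite /F con2 raddf0.
rewrite {}E -[LHS]/(\sum_i \sum_j F i j).
rewrite (eq_bigr (fun i => \sum_(j : 'I_n | (j < i)%N) F i j + \sum_(j : 'I_n | (i < j)%N)
  F i j)); last first.
  move=> i _; rewrite (bigID (fun j : 'I_n => (j < i)%N)) /=; congr (_ + _).
  rewrite (bigD1 i) ?ltnn //= F0 add0r; apply: eq_bigl => j.
  by rewrite -val_eqE /=; case: ltngtP.
rewrite big_split /= [X in _ + X](exchange_big_dep xpredT) //= -big_split /=.
apply: big1 => i _; rewrite -big_split /=; apply: big1 => j _.
by rewrite FA addNr.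
Qed.

(** Since e_T counts with degree #|T|, the coefficients of a p-chain of internal degree z have
    degree z - p, and [kd] preserves z. *)
Definition cprj (p : nat) (z : int) c : chain :=
  [ffun T : {set 'I_n} => if #|T| == p then pih (z - p%:Z) (c T) else 0].

Lemma cprj_is_zmod_morphism p z : zmod_morphism (cprj p z).
Proof.
by move=> c b; apply/ffunP=> T; rewrite !ffunE; case: ifP => _; rewrite ?subr0 ?raddfB.
Qed.
HB.instance Definition _ p z :=
  GRing.isZmodMorphism.Build _ _ (cprj p z) (cprj_is_zmod_morphism p z).

Lemma pih_sign z m (x : R) : pih z ((-1) ^+ m * x) = (-1) ^+ m * pih z x.
Proof. exact: raddfMsign. Qed.

Lemma cprj_kd p z c : cprj p z (kd c) = kd (cprj p.+1 z c).
Proof.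
apply/ffunP=> T; rewrite ffunE !kdE.
case: ifP => Tp; last first.
  apply/esym/big1 => i _; rewrite !ffunE; case: ifP => iT; first by rewrite mulr0.
  by rewrite cardsU1 iT add1n eqSS Tp !mulr0.
rewrite raddf_sum; apply: eq_bigr => i _ /=; rewrite (pihM _ _ (@ishomX k n i)) !ffunE.
case: ifP => iT; rewrite ?raddf0 // cardsU1 iT add1n eqSS Tp pih_sign.
by rewrite -addn1 PoszD opprD addrA.
Qed.

(** Unlike [cprj_kd] this covers p = 0, where both sides vanish because 0-chains have zero
    boundary. *)
Lemma cprj_kd0 p z c : (forall T, #|T| != p -> c T = 0) ->
  kd (cprj p z c) = cprj p.-1 z (kd c).
Proof.
case: p => [|p] cp; last by rewrite cprj_kd.
have kd0 b : (forall T, #|T| != 0%N -> b T = 0) -> kd b = 0.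
  move=> b0; apply/ffunP=> T; rewrite kdE big1 ?ffunE // => i _; rewrite ffunE.
  case: ifP => iT; rewrite ?mulr0 // b0 ?mulr0 //.
  by rewrite cardsU1 iT.
rewrite !kd0 ?raddf0 // => T T0; rewrite ffunE (negbTE T0) //.
Qed.

End Koszul.

(** * Koszul homology of subquotients of the polynomial ring *)

Section Exactness.
Variables (k : fieldType) (n : nat).
Local Notation R := {mpoly k[n]}.
Local Notation chain := {ffun {set 'I_n} -> {mpoly k[n]}}.
Implicit Types (c b : chain) (i : 'I_n) (T : {set 'I_n}) (P Q : set {mpoly k[n]}).

Lemma is_idealN P x : is_ideal P -> P x -> P (- x).
Proof. by move=> idP Px; rewrite -mulN1r; exact: (is_idealM idP). Qed.

Lemma is_idealB P x y : is_ideal P -> P x -> P y -> P (x - y).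
Proof. by move=> idP Px Py; apply: (is_idealD idP) => //; exact: is_idealN. Qed.

Lemma is_ideal_sum P (I : Type) (r : seq I) (C : pred I) (F : I -> R) :
  is_ideal P -> (forall j, C j -> P (F j)) -> P (\sum_(j <- r | C j) F j).
Proof.
by move=> idP PF; elim/big_rec: _ => [|i x Ci Px];
  [exact: is_ideal0|apply: (is_idealD idP) => //; exact: PF].
Qed.

Lemma is_ideal_setT : is_ideal (setT : set R). Proof. by []. Qed.

Lemma is_ideal_zero : is_ideal ([set 0] : set R).
Proof.
by split => // [x y -> ->|a x ->]; rewrite /= ?addr0 ?mulr0.
Qed.

(* The p-chains of internal degree z, the basis element e_T having degree #|T|. *)
Definition ischain (p : nat) (z : int) c := cprj p z c = c.

Definition cin P c := forall T, P (c T).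

Lemma cprj_chain p z c : ischain p z (cprj p z c).
Proof.
by apply/ffunP=> T; rewrite !ffunE; case: ifP => // ->; rewrite pih_pih eqxx.
Qed.

Lemma ischainP p z c : ischain p z c <->
  (forall T, #|T| != p -> c T = 0) /\ (forall T, ishom (z - p%:Z) (c T)).
Proof.
split=> [cE|[c0 ch]].
  split=> T; rewrite -cE ffunE; first by move/negbTE->.
  by case: ifP => _; [exact: pihP|exact: ishom0].
apply/ffunP=> T; rewrite ffunE; case: ifPn => [_|/c0 ->//].
by rewrite pih_id.
Qed.

Lemma ischainD p z c b : ischain p z c -> ischain p z b -> ischain p z (c + b).
Proof. by move=> cE bE; rewrite /ischain raddfD /= cE bE. Qed.

Lemma ischainB p z c b : ischain p z c -> ischain p z b -> ischain p z (c - b).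
Proof. by move=> cE bE; rewrite /ischain raddfB /= cE bE. Qed.

Lemma ischain_kd p z c : ischain p.+1 z c -> ischain p z (kd c).
Proof. by move=> cE; rewrite /ischain cprj_kd cE. Qed.

Lemma kd_supp0 c : (forall T, #|T| != 0%N -> c T = 0) -> kd c = 0.
Proof.
move=> c0; apply/ffunP=> T; rewrite kdE big1 ?ffunE // => i _; rewrite ffunE.
case: ifP => iT; rewrite ?mulr0 // c0 ?mulr0 //.
by rewrite cardsU1 iT.
Qed.

Lemma kd_chain0 z c : ischain 0 z c -> kd c = 0.
Proof. by case/ischainP=> c0 _; exact: kd_supp0. Qed.

Lemma cinD P c b : is_ideal P -> cin P c -> cin P b -> cin P (c + b).
Proof. by move=> idP Pc Pb T; rewrite ffunE; exact: (is_idealD idP). Qed.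

Lemma cinN P c : is_ideal P -> cin P c -> cin P (- c).
Proof. by move=> idP Pc T; rewrite ffunE; exact: (is_idealN idP). Qed.

Lemma cinB P c b : is_ideal P -> cin P c -> cin P b -> cin P (c - b).
Proof. by move=> idP Pc Pb; apply: cinD => //; exact: cinN. Qed.

Lemma cinS P Q c : P `<=` Q -> cin P c -> cin Q c.
Proof. by move=> PQ Pc T; exact: PQ. Qed.

Lemma cin_con P i c : is_ideal P -> cin P c -> cin P (con i c).
Proof.
move=> idP Pc T; rewrite ffunE; case: ifP => _; first exact: is_ideal0.
by apply: (is_idealM idP).
Qed.

Lemma cin_ext P i c : is_ideal P -> cin P c -> cin P (ext i c).
Proof.
move=> idP Pc T; rewrite ffunE; case: ifP => _; last exact: is_ideal0.
by apply: (is_idealM idP).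
Qed.

Lemma cin_kd P c : is_ideal P -> cin P c -> cin P (kd c).
Proof.
move=> idP Pc T; rewrite kdE; apply: is_ideal_sum => // i _.
by apply: (is_idealM idP); exact: cin_con.
Qed.

Lemma cin_zero c : cin [set 0] c <-> c = 0.
Proof.
split=> [c0|->]; first by apply/ffunP=> T; rewrite ffunE; exact: c0.
by move=> T; rewrite ffunE.
Qed.

Lemma cin0 P : is_ideal P -> cin P 0.
Proof. by move=> idP T; rewrite ffunE; exact: is_ideal0. Qed.

(* The Koszul homology H_p(x_1, ..., x_n; P/Q) vanishes in internal degree z. *)
Definition exact P Q p z := forall c, ischain p z c -> cin P c -> cin Q (kd c) ->
  exists b, [/\ ischain p.+1 z b, cin P b & cin Q (c - kd b)].

(** The piece H_p(P/Q) -> H_p(P'/Q) -> H_p(P'/P) of the long exact sequence. *)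
Lemma exact_extension P' P Q p z :
  is_ideal P -> is_ideal Q -> is_ideal P' -> Q `<=` P -> P `<=` P' ->
  exact P Q p z -> exact P' P p z -> exact P' Q p z.
Proof.
move=> idP idQ idP' QP PP' exPQ exP'P c cz P'c Qdc.
have [b [bz P'b Pcb]] := exP'P c cz P'c (cinS QP Qdc).
have [||b' [b'z Pb' Qcb]] := exPQ (c - kd b) _ Pcb.
- by apply: ischainB => //; exact: ischain_kd.
- by rewrite raddfB /= kdd subr0.
exists (b + b'); split; first exact: ischainD.
  by apply: cinD => //; exact: cinS Pb'.
by rewrite raddfD /= opprD addrA.
Qed.

(** The piece H_(p+1)(P'/P) -> H_p(P/Q) -> H_p(P'/Q) of the long exact sequence; its shift to p + 1
    becomes the 1 in both bounds. *)
Lemma exact_kernel P' P Q p z :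
  is_ideal P -> is_ideal Q -> is_ideal P' -> Q `<=` P -> P `<=` P' ->
  exact P' Q p z -> exact P' P p.+1 z -> exact P Q p z.
Proof.
move=> idP idQ idP' QP PP' exP'Q exP'P c cz Pc Qdc.
have [b [bz P'b Qcb]] := exP'Q c cz (cinS PP' Pc) Qdc.
have Pdb : cin P (kd b).
  rewrite -[kd b](subKr c); apply: cinB => //; exact: cinS Qcb.
have [b' [b'z P'b' Pbb']] := exP'P b bz P'b Pdb.
exists (b - kd b'); split=> //.
  by apply: ischainB => //; exact: ischain_kd.
by rewrite raddfB /= kdd subr0.
Qed.

(** This is p minus its value at X_i = 0, divided by X_i. *)
Definition qdiv i (p : R) : R :=
  \sum_(m : 'X_{1..n < msize p}) p@_(m + U_(i)) *: 'X_[m].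

Lemma mcoeff_qdiv i p m : (qdiv i p)@_m = p@_(m + U_(i)).
Proof.
have [lt|ge] := ltnP (mdeg m) (msize p);
  first by rewrite /qdiv (@mcoeff_mpoly _ _ (fun m => p@_(m + U_(i)))).
rewrite raddf_sum big1 /= => [|[m' m'p] _].
  apply/esym/memN_msupp_eq0; apply: msize_mdeg_ge.
  by rewrite (leq_trans ge) // mdegD leq_addr.
rewrite mcoeffZ mcoeffX; case: eqP => [/= mm|]; last by rewrite mulr0.
by have := m'p; rewrite mm ltnNge ge.
Qed.

Lemma qdiv_is_zmod_morphism i : zmod_morphism (qdiv i : R -> R).
Proof. by move=> p q; apply/mpolyP=> m; rewrite mcoeffB !mcoeff_qdiv mcoeffB. Qed.
HB.instance Definition _ i :=
  GRing.isZmodMorphism.Build R R (qdiv i) (qdiv_is_zmod_morphism i).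

Lemma mcoeff_XM i (p : R) m :
  ('X_i * p)@_m = if m i == 0%N then 0 else p@_(m - U_(i)).
Proof.
rewrite mulrC; case: ifPn => mi; last first.
  by rewrite -{1}(submK (m' := m) (m := U_(i)%MM)) ?lep1mP // addmC mcoeffMX.
apply/eqP; rewrite mcoeff_eq0 (perm_mem (msuppMX p _)); apply/mapP=> -[m' _ mE].
by move: mi; rewrite mE mnmDE mnm1E eqxx.
Qed.

Lemma qdivX i (p : R) : qdiv i ('X_i * p) = p.
Proof.
apply/mpolyP=> m; rewrite mcoeff_qdiv mcoeff_XM mnmDE mnm1E eqxx addn1 /=.
by rewrite addmK.
Qed.

Lemma qdivXj i j (p : R) : i != j -> qdiv i ('X_j * p) = 'X_j * qdiv i p.
Proof.
move=> ij; apply/mpolyP=> m.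
rewrite mcoeff_qdiv !mcoeff_XM mnmDE mnm1E (negbTE ij) addn0.
case: ifPn => // mj; rewrite mcoeff_qdiv; congr mcoeff; apply/mnmP=> l.
rewrite !(mnmDE, mnmBE, mnm1E); case: (eqVneq j l) => [<-|_]; last by rewrite !subn0.
by rewrite (negbTE ij) !addn0.
Qed.

Lemma qdivZ i (a : k) (p : R) : qdiv i (a *: p) = a *: qdiv i p.
Proof. by apply/mpolyP=> m; rewrite mcoeffZ !mcoeff_qdiv mcoeffZ. Qed.

Lemma pih_qdiv z i (p : R) : pih z (qdiv i p) = qdiv i (pih (z + 1) p).
Proof.
apply/mpolyP=> m; rewrite mcoeff_qdiv !mcoeff_pih mcoeff_qdiv mdegD mdeg1 PoszD.
by rewrite (inj_eq (addIr _)).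
Qed.

Definition rho i (p : R) : R := p - 'X_i * qdiv i p.

Lemma mcoeff_rho i (p : R) m : (rho i p)@_m = if m i == 0%N then p@_m else 0.
Proof.
rewrite mcoeffB mcoeff_XM; case: ifPn => mi; first by rewrite subr0.
by rewrite mcoeff_qdiv submK ?subrr // lep1mP.
Qed.

(* The divided difference [qdiv i] yields a homotopy from the identity to the
   projection [kred i], which sets X_i = 0 and drops the e_T with i in T. *)
Definition khom i c : chain := cmap (qdiv i) (ext i c).

Definition kred i c : chain := [ffun T : {set 'I_n} => if i \in T then 0 else rho i (c T)].

(** For j other than i, [qdiv i] commutes with X_j while [con j] and [ext i] anticommute, so only
    the terms of index i survive. *)
Lemma kd_khom i c : kd (khom i c) + khom i (kd c) = c - kred i c.
Proof.
have E j : con j (khom i c) = cmap (qdiv i) (con j (ext i c)) by rewrite cmap_con.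
have E' : khom i (kd c) = \sum_j cmap (qdiv i) (cmap (lmul 'X_j) (ext i (con j c))).
  by rewrite /khom /kd !raddf_sum; apply: eq_bigr => j _; rewrite cmap_ext.
rewrite E' {1}/kd -big_split /= (bigD1 i) //= big1 ?addr0 => [|j ji].
  rewrite E -[X in X - _](con_ext_same i c).
  apply/ffunP=> T; rewrite !ffunE /lmul qdivX !inE eqxx /=.
  case: (boolP (i \in T)) => iT; first by rewrite subr0 raddf0 mulr0.
  rewrite addr0 /rho addr0.
  set x := (-1) ^+ _ * _.
  have -> : x = c T.
    by rewrite /x finset.setU1K // ksignU // ltnn mulrA -exprD addnn -muln2 exprM
      sqrr_sign mul1r.
  by rewrite opprB addrC subrK.
rewrite E con_ext // raddfN /=.
apply/ffunP=> T; rewrite !ffunE /lmul.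
by rewrite mulrN qdivXj 1?eq_sym // addNr.
Qed.

Lemma ischain_khom i p z c : ischain p z c -> ischain p.+1 z (khom i c).
Proof.
case/ischainP=> c0 ch; apply/ischainP; split=> T.
  move=> Tp; rewrite !ffunE; case: ifP => iT; last by rewrite raddf0.
  rewrite c0 ?mulr0 ?raddf0 //; apply: contra Tp => /eqP <-.
  by rewrite [X in X == _](cardsD1 i) iT.
apply: ishom_pih; rewrite ffunE pih_qdiv -addn1 PoszD opprD addrA subrK.
rewrite pih_id // ffunE; case: ifP => _; last exact: ishom0.
by apply: ishom_pih; rewrite pih_sign pih_id.
Qed.

Lemma ischain_kred i p z c : ischain p z c -> ischain p z (kred i c).
Proof.
case/ischainP=> c0 ch; apply/ischainP; split=> T.
  by move/c0 => cT; rewrite ffunE cT /rho raddf0 mulr0 subrr if_same.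
rewrite ffunE; case: ifP => _; first exact: ishom0.
move=> m; rewrite mcoeff_msupp mcoeff_rho; case: ifP; rewrite ?eqxx // => _.
by rewrite -mcoeff_msupp; exact: ch.
Qed.

(** The variables of L are eliminated one at a time by [kd_khom]; stability under [qdiv] lets the
    homotopies act on the Koszul complex of P/Q. With all variables this gives acyclicity, with the
    Y variables base change from A to R. *)
Lemma koszul_reduce P Q (L : seq 'I_n) p z c :
  is_ideal P -> is_ideal Q ->
  (forall i x, i \in L -> P x -> P (qdiv i x)) ->
  (forall i x, i \in L -> Q x -> Q (qdiv i x)) ->
  ischain p z c -> cin P c -> cin Q (kd c) ->
  exists b c', [/\ ischain p.+1 z b /\ cin P b, ischain p z c' /\ cin P c',
    cin Q (kd c'), cin Q (c - kd b - c') &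
    forall i T, i \in L -> (i \in T -> c' T = 0) /\
      (forall m, m \in msupp (c' T) -> m i = 0%N)].
Proof.
move=> idP idQ; elim: L => [|i L IH] PL QL cz Pc Qc.
  exists 0, c; split=> //; first by split; [rewrite /ischain raddf0|exact: cin0].
  by rewrite raddf0 subr0 subrr; exact: cin0.
have [||b [c' [[bz Pb] [c'z Pc'] Qdc' Qc' L0]]] := IH _ _ cz Pc Qc.
- by move=> j x jL; apply: PL; rewrite inE jL orbT.
- by move=> j x jL; apply: QL; rewrite inE jL orbT.
have qP : cin P (khom i c').
  by move=> T; rewrite ffunE; apply: PL; rewrite ?mem_head //; exact: cin_ext.
have qQ : cin Q (khom i (kd c')).
  by move=> T; rewrite ffunE; apply: QL; rewrite ?mem_head //; exact: cin_ext.
have E := kd_khom i c'.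
exists (b + khom i c'), (kred i c'); split.
- by split; [apply: ischainD => //; exact: ischain_khom|exact: cinD].
- split; first exact: ischain_kred.
  have -> : kred i c' = c' - (kd (khom i c') + khom i (kd c')) by rewrite E subKr.
  apply: cinB => //; apply: cinD => //; first exact: cin_kd.
  move=> T; rewrite ffunE; apply: PL; rewrite ?mem_head //.
  by apply: cin_ext => //; exact: cin_kd.
- have -> : kred i c' = c' - (kd (khom i c') + khom i (kd c')) by rewrite E subKr.
  by rewrite raddfB raddfD /= kdd add0r; apply: cinB => //; exact: cin_kd.
- rewrite raddfD /= opprD -!addrA.
  have -> : c + (- kd b + (- kd (khom i c') - kred i c')) = (c - kd b - c') + khom i (kd
    c').
    have -> : khom i (kd c') = c' - kred i c' - kd (khom i c') by rewrite -E addrC addKr.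
    by rewrite !addrA subrK addrAC.
  exact: cinD.
- move=> j T; rewrite inE => /predU1P[->|jL].
    rewrite ffunE; split=> [->//|m].
    by case: ifP => _; rewrite ?msupp0 // mcoeff_msupp mcoeff_rho; case: (m i =P 0%N);
      rewrite ?eqxx.
  (* Reducing along i does not reintroduce a variable eliminated earlier. *)
  have [jT jm] := L0 j T jL; rewrite ffunE; split=> [/jT ->|m].
    by rewrite /rho raddf0 mulr0 subrr if_same.
  case: ifP => _; rewrite ?msupp0 // mcoeff_msupp mcoeff_rho.
  by case: ifP => _; rewrite ?eqxx // -mcoeff_msupp; exact: jm.
Qed.

(** After eliminating every variable only a constant multiple of the empty exterior product is left,
    and it lives in bidegree (0, 0). *)
Lemma koszul_acyclic p z : (p != 0%N) || (z != 0) -> exact setT [set 0] p z.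
Proof.
move=> pz c cz _ dc0.
have [|b [c' [[bz _] [c'z _] _ E L0]]] := koszul_reduce (L := enum 'I_n)
  is_ideal_setT is_ideal_zero (fun _ _ _ _ => Logic.I) _ cz (fun T => Logic.I) dc0.
  by move=> i x _ ->; exact: raddf0.
suff c'E : c' = 0 by exists b; split=> //; rewrite c'E subr0 in E.
apply/ffunP=> T; rewrite [RHS]ffunE.
have [T0|[i iT]] := set_0Vmem T; last by apply: (L0 i T _).1; rewrite ?mem_enum.
have [c'0 c'h] := (ischainP p z c').1 c'z.
case: (eqVneq p 0%N) pz c'0 c'h => [->|p0 _ c'0 _]; last first.
  by apply: c'0; rewrite T0 cards0 eq_sym.
rewrite /= subr0 => z0 _ c'h.
apply/eqP; apply: contraNT z0 => c'T.
have [m mT] : exists m, m \in msupp (c' T).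
  case Em : (msupp (c' T)) c'T => [|m r]; last by exists m; rewrite mem_head.
  by rewrite (msuppnil0 Em) eqxx.
rewrite -(c'h T m mT) -[0]/(0%:Z) eqz_nat mdegE big1 // => i _.
by apply: (L0 i T _).2; rewrite ?mem_enum.
Qed.

End Exactness.

(** * Hilbert's basis theorem *)

Section Dickson.

Lemma nat_monotone_subseq (g : nat -> nat) : exists phi : nat -> nat,
  (forall i j, (i < j)%N -> (phi i < phi j)%N) /\
  (forall i j, (i <= j)%N -> (g (phi i) <= g (phi j))%N).
Proof.
(* Beyond every N, g attains its minimum; iterating the choice of such a point gives the
   subsequence. *)
have H N : exists m, (N < m)%N /\ forall m', (N < m')%N -> (g m <= g m')%N.
  have ex : exists v, `[< exists2 m, (N < m)%N & g m = v >].
    by exists (g N.+1); apply/asboolP; exists N.+1.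
  have [v /asboolP [m Nm gm] vmin] := ex_minnP ex.
  by exists m; split=> // m' Nm'; rewrite gm vmin //; apply/asboolP; exists m'.
have [h hP] := choice H.
pose phi i := iter i.+1 h 0%N.
have phiS i : (phi i < phi i.+1)%N by rewrite {2}/phi iterS; exact: (hP _).1.
have gS i : (g (phi i) <= g (phi i.+1))%N.
  apply: (hP (iter i h 0%N)).2; apply: ltn_trans (phiS i).
  exact: (hP _).1.
exists phi; split=> i j; last exact: (homo_leq leqnn leq_trans gS).
exact: (homo_ltn ltn_trans phiS).
Qed.

(** Subsequences are extracted for one coordinate after the other, until all coordinates are
    monotone. *)
Lemma dickson_seq n (f : nat -> 'X_{1..n}) :
  exists i j, (i < j)%N /\ (f i <= f j)%MM.
Proof.
suff [phi [phi_lt fphi]] : exists phi : nat -> nat,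
    (forall i j, (i < j)%N -> (phi i < phi j)%N) /\
    (forall l i j, l \in enum 'I_n -> (i <= j)%N -> (f (phi i) l <= f (phi j) l)%N).
  exists (phi 0%N), (phi 1%N); split; first exact: phi_lt.
  by apply/mnm_lepP => l; apply: fphi; rewrite ?mem_enum.
elim: (enum 'I_n) => [|l L [phi [phi_lt fphi]]]; first by exists id.
have [psi [psi_lt gpsi]] := nat_monotone_subseq (fun i => f (phi i) l).
exists (phi \o psi); split=> [i j ij|l' i j]; first exact/phi_lt/psi_lt.
rewrite inE => /predU1P[->|l'L] ij; first exact: gpsi.
apply: fphi => //; move: ij; rewrite leq_eqVlt => /predU1P[->//|ij].
exact/ltnW/psi_lt.
Qed.

End Dickson.

Section Noetherian.
Variables (k : fieldType) (n : nat).
Local Notation R := {mpoly k[n]}.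

(** If I were not finitely generated, one could keep choosing an element of I outside the ideal of
    the earlier ones, with least leading monomial. By Dickson an earlier leading monomial divides a
    later one, and cancelling the leading term contradicts leastness. *)
Lemma hilbert_basis (I : set R) : is_ideal I ->
  exists s : seq R, (forall x, x \in s -> I x) /\
    forall J, is_ideal J -> (forall x, x \in s -> J x) -> I `<=` J.
Proof.
move=> idI; apply: contrapT => nfg.
pose inspan (s : seq R) x := forall J, is_ideal J -> (forall y, y \in s -> J y) -> J x.
have H (s : seq R) : exists x, (forall y, y \in s -> I y) ->
    [/\ I x, ~ inspan s x & forall y, I y -> (mlead y < mlead x)%O -> inspan s y].
  have [sI|] := pselect (forall y, y \in s -> I y); last by exists 0.
  have [m mP] : exists m, exists x, [/\ mlead x = m, I x & ~ inspan s x].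
    apply: contrapT => none; apply: nfg; exists s; split=> // J idJ sJ x Ix.
    by apply: contrapT => Jx; apply: none; exists (mlead x), x; split=> // /(_ J idJ sJ).
  elim/(@ltmwf n): m mP => m IH [x [xm Ix sx]].
  have [[y [Iy yx sy]]|no] := pselect (exists y, [/\ I y, (mlead y < m)%O & ~ inspan s y]).
    by apply: IH yx _; exists y.
  exists x => _; split=> // y Iy; rewrite xm => yx.
  by apply: contrapT => sy; apply: no; exists y.
have [nxt nxtP] := choice H.
pose S i := iter i (fun s => nxt s :: s) [::].
have SI i y : y \in S i -> I y.
  elim: i y => [//|i IH] y; rewrite inE => /predU1P[->|]; last exact: IH.
  by have [] := nxtP (S i) IH.
have [i [j [ij mij]]] := dickson_seq (fun i => mlead (nxt (S i))).
have [Ig sg _] := nxtP (S i) (SI i).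
have [Ih sh hmin] := nxtP (S j) (SI j).
have gS : nxt (S i) \in S j.
  elim: j ij {mij Ih sh hmin} => // j IH; rewrite ltnS leq_eqVlt inE.
  by case/predU1P=> [->|/IH ->]; rewrite ?eqxx ?orbT.
move: (nxt (S i)) (nxt (S j)) Ig sg Ih sh hmin gS mij => g h Ig sg Ih sh hmin gS mij.
have g0 : g != 0 by apply/eqP=> g0; apply: sg => J idJ _; rewrite g0; exact: is_ideal0.
have h0 : h != 0 by apply/eqP=> h0; apply: sh => J idJ _; rewrite h0; exact: is_ideal0.
have lg0 : g@_(mlead g) != 0 by rewrite mleadc_eq0.
have lh0 : h@_(mlead h) != 0 by rewrite mleadc_eq0.
(* The multiplier for which [t * g] has the leading term of h. *)
pose t := (h@_(mlead h) / g@_(mlead g)) *: 'X_[mlead h - mlead g] : R.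
have t0 : t != 0.
  rewrite -mleadc_eq0 mleadcZE mleadXm mcoeffX eqxx mulr1.
  by rewrite mulf_neq0 ?invr_neq0.
have ltg : mlead (t * g) = mlead h.
  rewrite mleadM // mleadZ ?mulf_neq0 ?invr_neq0 // mleadXm.
  exact: submK.
have ctg : (t * g)@_(mlead h) = h@_(mlead h).
  rewrite -{1}ltg mleadM // mleadcM mleadcZE mleadXm mcoeffX eqxx mulr1.
  by rewrite divfK.
have Iy : I (h - t * g).
  by apply: is_idealB => //; exact: is_idealM.
have sy : ~ inspan (S j) (h - t * g).
  move=> sy; apply: sh => J idJ SJ; rewrite -[h](subrK (t * g)).
  by apply: (is_idealD idJ); [exact: sy|apply: (is_idealM idJ); exact: SJ].
have y0 : h - t * g != 0.
  by apply/eqP=> y0; apply: sy => J idJ _; rewrite y0; exact: is_ideal0.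
apply: sy; apply: hmin => //; rewrite lt_neqAle; apply/andP; split.
  apply/eqP=> E; have := mlead_supp y0.
  by rewrite E mcoeff_msupp mcoeffB ctg subrr eqxx.
by apply: le_trans (mleadB_le _ _) _; rewrite ltg joinxx.
Qed.

Record is_submod a (N : set 'rV[R]_a) : Prop := IsSubmod {
  is_submod0 : N 0;
  is_submodD : forall x y, N x -> N y -> N (x + y);
  is_submodZ : forall (c : R) x, N x -> N (c *: x) }.

Lemma is_submodB a (N : set 'rV[R]_a) x y : is_submod N -> N x -> N y -> N (x - y).
Proof.
by move=> sN Nx Ny; apply: (is_submodD sN) => //; rewrite -scaleN1r; exact: is_submodZ.
Qed.

Lemma is_submod_sum a (N : set 'rV[R]_a) (T : Type) (r : seq T) (C : pred T) (F : T ->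
  'rV[R]_a) :
  is_submod N -> (forall i, C i -> N (F i)) -> N (\sum_(i <- r | C i) F i).
Proof.
by move=> sN NF; elim/big_rec: _ => [|i x Ci Nx];
  [exact: is_submod0|apply: (is_submodD sN) => //; exact: NF].
Qed.

(** Induction on the number t of leading coordinates that may be nonzero: lifts of generators of the
    ideal of last coordinates, together with generators of the submodule where that coordinate
    vanishes, generate N. *)
Lemma submod_fg a (N : set 'rV[R]_a) : is_submod N ->
  exists s : seq 'rV[R]_a, (forall x, x \in s -> N x) /\
    forall N', is_submod N' -> (forall x, x \in s -> N' x) -> N `<=` N'.
Proof.
suff H t : forall N : set 'rV[R]_a, is_submod N ->
    (forall w (u : 'I_a), N w -> (t <= u)%N -> w 0 u = 0) ->
    exists s : seq 'rV[R]_a, (forall x, x \in s -> N x) /\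
    forall N', is_submod N' -> (forall x, x \in s -> N' x) -> N `<=` N'.
  by move=> sN; apply: (H a) => // w u _; rewrite leqNgt ltn_ord.
elim: t => [|t IH] {}N sN Nt.
  exists [::]; split=> // N' sN' _ w Nw.
  suff -> : w = 0 by exact: is_submod0.
  by apply/rowP=> u; rewrite mxE; exact: Nt.
have [at_|ta] := leqP a t.
  by apply: IH => // w u Nw tu; have := leq_trans at_ tu; rewrite leqNgt ltn_ord.
pose u0 := Ordinal ta.
pose L : set R := [set x | exists2 w, N w & w 0 u0 = x].
have idL : is_ideal L.
  split; first by exists 0; rewrite ?mxE //; exact: is_submod0.
  - by move=> _ _ [w Nw <-] [v Nv <-]; exists (w + v); rewrite ?mxE //; exact: is_submodD.
  - by move=> c _ [w Nw <-]; exists (c *: w); rewrite ?mxE //; exact: is_submodZ.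
have [s [sL sP]] := hilbert_basis idL.
have H x : exists w, L x -> N w /\ w 0 u0 = x.
  have [[w Nw wx]|nL] := pselect (L x); first by exists w.
  by exists 0.
have [f fP] := choice H.
pose N0 : set 'rV[R]_a := [set w | N w /\ w 0 u0 = 0].
have [|w u [Nw w0]|s2 [s2N s2P]] := IH N0.
- split; first by split; rewrite ?mxE //; exact: is_submod0.
  + move=> x y [Nx x0] [Ny y0]; split; first exact: is_submodD.
    by rewrite mxE x0 y0 addr0.
  + move=> c x [Nx x0]; split; first exact: is_submodZ.
    by rewrite mxE x0 mulr0.
- rewrite leq_eqVlt => /predU1P[tu|]; last exact: Nt.
  by rewrite -[RHS]w0; congr (w 0 _); apply: val_inj.
exists (map f s ++ s2); split=> [x|N' sN' sN'P w Nw].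
  by rewrite mem_cat => /orP[/mapP[y /sL /fP[? _] ->] //|/s2N[]].
(* This ideal contains the generators of L, so the last coordinate of w is also that of an element
   of both N and N'. *)
pose L' : set R := [set x | exists2 w, N w /\ N' w & w 0 u0 = x].
have idL' : is_ideal L'.
  split; first by exists 0; rewrite ?mxE //; split; exact: is_submod0.
  - move=> _ _ [x [Nx N'x] <-] [v [Nv N'v] <-]; exists (x + v); rewrite ?mxE //.
    by split; exact: is_submodD.
  - move=> c _ [x [Nx N'x] <-]; exists (c *: x); rewrite ?mxE //.
    by split; exact: is_submodZ.
have [w' [Nw' N'w'] w'0] : L' (w 0 u0).
  apply: (sP _ idL'); last by exists w.
  move=> x sx; have [Nfx fx0] := fP x (sL x sx); exists (f x) => //; split=> //.
  by apply: sN'P; rewrite mem_cat map_f.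
rewrite -[w](subrK w'); apply: (is_submodD sN') => //.
apply: (s2P N') => // [x xs2|]; first by apply: sN'P; rewrite mem_cat xs2 orbT.
by split; [exact: is_submodB|rewrite !mxE w'0 subrr].
Qed.

End Noetherian.

(** * Minimal graded free resolutions *)

Section Resolution.
Variables (k : fieldType) (n : nat).
Local Notation R := {mpoly k[n]}.

Definition vpr a (deg : 'I_a -> int) z (w : 'rV[R]_a) : 'rV[R]_a :=
  \row_u pih (z - deg u) (w 0 u).

Lemma vpr_is_zmod_morphism a (deg : 'I_a -> int) z : zmod_morphism (vpr deg z).
Proof. by move=> x y; apply/rowP=> u; rewrite !mxE raddfB. Qed.
HB.instance Definition _ a (deg : 'I_a -> int) z :=
  GRing.isZmodMorphism.Build _ _ (vpr deg z) (vpr_is_zmod_morphism deg z).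

Definition hommx a b (dega : 'I_a -> int) (degb : 'I_b -> int) (M : 'M[R]_(a, b)) :=
  forall u v, ishom (dega u - degb v) (M u v).

Lemma vprM a b (dega : 'I_a -> int) (degb : 'I_b -> int) (M : 'M[R]_(a, b)) z w :
  hommx dega degb M -> vpr degb z (w *m M) = vpr dega z w *m M.
Proof.
move=> hM; apply/rowP=> v; rewrite !mxE raddf_sum; apply: eq_bigr => u _ /=.
rewrite !mxE mulrC (pihM _ _ (hM u v)) mulrC; congr (pih _ _ * _).
by rewrite opprB addrA subrK.
Qed.

Lemma vpr_sum a (deg : 'I_a -> int) (w : 'rV[R]_a) :
  exists s : seq int, w = \sum_(z <- s) vpr deg z w.
Proof.
pose zs : seq int := undup (flatten [seq [seq deg u + (mdeg m)%:Z | m <- msupp (w 0 u)] |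
  u <- enum 'I_a]).
exists zs; apply/rowP=> u; rewrite summxE; apply/mpolyP=> m; rewrite raddf_sum /=.
under eq_bigr do rewrite mxE mcoeff_pih.
have [mw|/memN_msupp_eq0 ->] := boolP (m \in msupp (w 0 u)); last first.
  by rewrite big1 // => z _; rewrite if_same.
have zu : deg u + (mdeg m)%:Z \in zs.
  by rewrite mem_undup; apply/flatten_mapP; exists u; rewrite ?mem_enum //; exact: map_f.
rewrite (big_rem _ zu) /= (addrC (deg u)) addrK eqxx big1_seq ?addr0 // => z /=.
rewrite mem_rem_uniq ?undup_uniq // inE => /andP[zne _].
by case: eqP => // zE; case/eqP: zne; rewrite /= zE subrK.
Qed.

(** Relations among the rows have coefficients in the maximal ideal: for homogeneous rows, the
    Nakayama form of being a minimal generating set. *)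
Definition mingen a b (M : 'M[R]_(a, b)) :=
  forall w : 'rV_a, w *m M = 0 -> forall u, (w 0 u)@_0%MM = 0.

(** Take a homogeneous generating family of least size: a relation with a unit coefficient in some
    degree would make one generator redundant. *)
Lemma graded_mingen b (degb : 'I_b -> int) (N : set 'rV[R]_b) :
  is_submod N -> (forall z w, N w -> N (vpr degb z w)) ->
  exists a (dega : 'I_a -> int) (M : 'M[R]_(a, b)),
    [/\ hommx dega degb M, forall w, N w <-> exists w', w = w' *m M & mingen M].
Proof.
move=> sN gN.
pose gen a := exists (dega : 'I_a -> int) (M : 'M[R]_(a, b)),
  hommx dega degb M /\ forall w, N w <-> exists w', w = w' *m M.
have ex : exists a, `[< gen a >].
  have [s [sN' sP]] := submod_fg sN.
  have [zs zsP] := choice (vpr_sum degb).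
  (* The generators found so far need not be homogeneous; L lists their homogeneous components with
     their degrees. *)
  pose L : seq (int * 'rV[R]_b) :=
    flatten [seq [seq (z, vpr degb z w) | z <- zs w] | w <- s].
  have LP x : x \in L -> N x.2 /\ vpr degb x.1 x.2 = x.2.
    case/flatten_mapP=> w /sN' Nw /mapP[z _ ->]; split; first exact: gN.
    by apply/rowP=> u; rewrite !mxE pih_pih eqxx.
  pose x0 : int * 'rV[R]_b := (0, 0).
  pose ML : 'M[R]_(size L, b) := \matrix_u (nth x0 L u).2.
  exists (size L); apply/asboolP.
  exists (fun u => (nth x0 L u).1), ML.
  have rowL (u : 'I_(size L)) : row u ML = (nth x0 L u).2 by rewrite rowK.
  split=> [u v|w].
    have [_ E] := LP _ (mem_nth x0 (ltn_ord u)).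
    by rewrite mxE -E mxE; exact: pihP.
  split=> [Nw|[w' ->]]; last first.
    rewrite mulmx_sum_row; apply: is_submod_sum => // u _.
    by apply: (is_submodZ sN); rewrite rowL; apply: (LP _ _).1; exact: mem_nth.
  pose N' : set 'rV[R]_b := [set w | exists w', w = w' *m ML].
  have sN'' : is_submod N'.
    split; first by exists 0; rewrite mul0mx.
      by move=> _ _ [x ->] [y ->]; exists (x + y); rewrite mulmxDl.
    by move=> c _ [x ->]; exists (c *: x); rewrite scalemxAl.
  have LN' x : x \in L -> N' x.2.
    rewrite -index_mem => xL; exists (delta_mx 0 (Ordinal xL)).
    by rewrite -rowE rowL /= nth_index // -index_mem.
  apply: (sP N') => // x xs; rewrite (zsP x).
  rewrite big_seq; apply: is_submod_sum => // z zz.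
  apply: (LN' (z, vpr degb z x)); apply/flatten_mapP; exists x => //.
  exact: map_f.
have [a /asboolP [dega [M [hM NM]]] amin] := ex_minnP ex.
exists a, dega, M; split=> // w wM u.
apply: contrapT => wu.
case: a dega M hM NM amin w u wM wu => [|a] dega M hM NM amin w u wM wu;
  first by case: u wu.
suff : gen a by move/asboolP/amin; rewrite ltnn.
exists (dega \o lift u), (row' u M); split=> [v v'|x].
  by rewrite mxE; exact: hM.
have rw (y : 'rV_a.+1) : y *m M = y 0 u *: row u M + col' u y *m row' u M.
  rewrite mulmx_sum_row (bigD1_ord u) //= mulmx_sum_row; congr (_ + _).
  by apply: eq_bigr => v _; rewrite mxE; congr (_ *: _); apply/rowP=> j; rewrite !mxE.
rewrite NM; split=> [[x' ->]|[x' ->]]; last first.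
  exists (\row_v if unlift u v is Some v' then x' 0 v' else 0).
  rewrite rw mxE unlift_none scale0r add0r; congr (_ *m _).
  by apply/rowP=> v; rewrite !mxE liftK.
suff [y yE] : exists y, row u M = y *m row' u M.
  by exists (x' 0 u *: y + col' u x'); rewrite rw mulmxDl -scalemxAl -yE.
(* In this degree the u-th coefficient of the relation is exactly the constant term c, hence
   invertible. *)
pose w2 := vpr dega (dega u) w.
have w2M : w2 *m M = 0 by rewrite -(vprM _ _ hM) wM raddf0.
pose c := (w 0 u)@_0%MM.
have w2u : w2 0 u = c%:MP.
  rewrite mxE subrr; apply/mpolyP=> m; rewrite mcoeff_pih mcoeffC eqz_nat mdeg_eq0 eq_sym.
  by case: (eqVneq m 0%MM) => [->|_]; rewrite ?mulr1 ?mulr0.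
exists ((- c^-1)%:MP *: col' u w2).
rewrite -scalemxAl; have := w2M; rewrite rw w2u => /eqP; rewrite addr_eq0 => /eqP E.
rewrite -[col' u w2 *m _]opprK -E scalerN -scaleNr -mpolyCN opprK scalerA -mpolyCM.
by rewrite mulVf ?scale1r //; apply/eqP.
Qed.

Record syzygies b (degb : 'I_b -> int) := Syzygies {
  syz_rank : nat;
  syz_deg : 'I_syz_rank -> int;
  syz_mx : 'M[R]_(syz_rank, b);
  syz_hom : hommx syz_deg degb syz_mx;
  syz_min : mingen syz_mx }.

Lemma next_syzygies b (degb : 'I_b -> int) (D : syzygies degb) :
  exists D' : syzygies (@syz_deg b degb D),
    forall w : 'rV_(syz_rank D), w *m syz_mx D = 0 <->
      exists w' : 'rV_(syz_rank D'), w = w' *m syz_mx D'.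
Proof.
have [||a [dega [M [hM NM mM]]]] := @graded_mingen _ (@syz_deg b degb D)
   [set w | w *m syz_mx D = 0].
- split=> [|x y /= xD yD|c x /= xD]; first by rewrite /= mul0mx.
    by rewrite mulmxDl xD yD addr0.
  by rewrite -scalemxAl xD scaler0.
- by move=> z w /= wD; rewrite -(vprM _ _ (@syz_hom _ _ D)) wD raddf0.
by exists (Syzygies hM mM).
Qed.

(** The matrix sizes change at each step of the recursion, so rank, degrees and the matrix mapping
    onto the next kernel travel together. *)
Definition stage := {b : nat & {degb : 'I_b -> int & syzygies degb}}.
Definition stage_rank (t : stage) := projT1 t.
Definition stage_deg (t : stage) : 'I_(stage_rank t) -> int := projT1 (projT2 t).
Definition stage_syz (t : stage) : syzygies (@stage_deg t) := projT2 (projT2 t).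

Definition next_stage (t : stage) : stage :=
  existT _ (syz_rank (stage_syz t)) (existT _ (@syz_deg _ _ (stage_syz t))
    (projT1 (cid (next_syzygies (stage_syz t))))).

Fixpoint stages (t : stage) i := if i is j.+1 then next_stage (stages t j) else t.

(** F_0 is the ring itself, generated by 1 in degree 0; the entries of F_1 -> F_0 then generate
    I. *)
Definition standard (I : set R) (F : graded_free_resolution I) :=
  exists u0 : 'I_(gfr_rank F 0),
    [/\ forall u, u = u0, gfr_aug F u0 0 = 1 & gfr_deg u0 = 0].

Lemma standard_minimal_resolution (I : set R) :
  is_ideal I -> homogeneous_ideal I -> (forall x, I x -> x@_0%MM = 0) ->
  exists F : graded_free_resolution I, minimal_resolution F /\ standard F.
Proof.
move=> idI homI Im.
have pihI z x : I x -> I (pih z x).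
  by case: z => d /= Ix; [exact: homI|exact: is_ideal0].
pose N : set 'rV[R]_1 := [set w | I (w 0 0)].
have [||a [dega [M [hM NM mM]]]] := @graded_mingen 1 (fun=> 0) N.
- split=> [|x y|c x]; rewrite /N /= mxE; first exact: is_ideal0.
    exact: is_idealD.
  exact: is_idealM.
- by move=> z w Nw; rewrite /N /= mxE; exact: pihI.
pose t0 : stage := existT _ 1%N (existT _ (fun=> 0) (Syzygies hM mM)).
pose st := stages t0.
pose rk i := stage_rank (st i).
pose dg i : 'I_(rk i) -> int := stage_deg (t := st i).
pose df i : 'M[R]_(rk i.+1, rk i) := syz_mx (stage_syz (st i)).
have dfh i : hommx (@dg i.+1) (@dg i) (df i) by exact: (@syz_hom _ _ (stage_syz (st i))).
have ex0 (w : 'rV[R]_1) : I (w 0 0) <-> exists w', w = w' *m df 0%N by exact: NM.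
have exS i (w : 'rV_(rk i.+1)) : w *m df i = 0 <-> exists w', w = w' *m df i.+1.
  exact: (projT2 (cid (next_syzygies (stage_syz (st i)))) w).
have ishom1 : ishom 0 (1 : R) by move=> m; rewrite msupp1 inE => /eqP ->; rewrite mdeg0.
have augE (w : 'rV[R]_1) : (w *m (1%:M : 'M[R]_1)) 0 0 = w 0 0 by rewrite mulmx1.
unshelve eexists.
  apply: (@GradedFreeResolution k n I rk dg (1%:M : 'M[R]_1) df) => //.
  - move=> u m; rewrite mxE (ord1 u) eqxx mulr1n; exact: ishom1.
  - by move=> i u v m /dfh ->; rewrite subrK.
  - by move=> p; exists (p%:M : 'M[R]_1); rewrite augE mxE eqxx mulr1n subrr;
    exact: is_ideal0.
  - by move=> w; rewrite augE; exact: ex0.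
split; last by exists (ord0 : 'I_1); split=> //= [u|]; rewrite ?mxE //; exact: (ord1 u).
case=> [|i] u v /=.
  (* Into F_0 the entries lie in I, which has no constant terms; at later steps each row is a
     relation of the previous matrix, and [mingen] applies. *)
  have : I ((row u (df 0%N)) 0 0).
    by apply/ex0; exists (delta_mx 0 u); rewrite rowE.
  by rewrite mxE (ord1 v) => /Im.
have : row u (df i.+1) *m df i = 0 by apply/exS; exists (delta_mx 0 u); rewrite rowE.
by move/(@syz_min _ _ (stage_syz (st i)))/(_ v); rewrite mxE.
Qed.

End Resolution.

(** * Betti numbers and Koszul homology *)

Section Families.
Variables (k : fieldType) (n : nat).
Local Notation R := {mpoly k[n]}.
Local Notation chain := {ffun {set 'I_n} -> {mpoly k[n]}}.

(** A family of chains indexed by the basis of a free module is a Koszul chain with coefficients in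
    that module; [cmul] applies the map M to the coefficients. *)
Definition cmul a b (w : 'I_a -> chain) (M : 'M[R]_(a, b)) (v : 'I_b) : chain :=
  [ffun T => \sum_u w u T * M u v].

Definition fchain a (deg : 'I_a -> int) p z (w : 'I_a -> chain) :=
  forall u, ischain p (z - deg u) (w u).

Definition fprj a (deg : 'I_a -> int) p z (w : 'I_a -> chain) u :=
  cprj p (z - deg u) (w u).

Lemma cmulE a b (w : 'I_a -> chain) (M : 'M[R]_(a, b)) v T :
  cmul w M v T = ((\row_u w u T) *m M) 0 v.
Proof. by rewrite ffunE mxE; apply: eq_bigr => u _; rewrite mxE. Qed.

Lemma kd_cmul a b (w : 'I_a -> chain) (M : 'M[R]_(a, b)) v :
  kd (cmul w M v) = cmul (fun u => kd (w u)) M v.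
Proof.
apply/ffunP=> T; rewrite kdE ffunE.
rewrite (eq_bigr (fun i => \sum_u ('X_i * con i (w u) T) * M u v)); last first.
  move=> i _; rewrite !ffunE; case: ifP => iT.
    rewrite mulr0 big1 // => u _; rewrite ffunE iT mulr0 mul0r //.
  rewrite mulr_sumr mulr_sumr; apply: eq_bigr => u _.
  by rewrite ffunE iT !mulrA.
rewrite exchange_big; apply: eq_bigr => u _ /=.
by rewrite kdE mulr_suml.
Qed.

Lemma cmul_comp a b c (w : 'I_a -> chain) (M : 'M[R]_(a, b)) (M' : 'M[R]_(b, c)) v :
  cmul (cmul w M) M' v = cmul w (M *m M') v.
Proof.
apply/ffunP=> T; rewrite !cmulE mulmxA; congr ((_ *m _) _ _).
by apply/rowP=> u; rewrite mxE cmulE.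
Qed.

Lemma cmulB a b (w y : 'I_a -> chain) (M : 'M[R]_(a, b)) v :
  cmul (fun u => w u - y u) M v = cmul w M v - cmul y M v.
Proof.
apply/ffunP=> T; rewrite !ffunE -sumrB; apply: eq_bigr => u _.
by rewrite !ffunE mulrBl.
Qed.

Lemma eq_cmul a b (w y : 'I_a -> chain) (M : 'M[R]_(a, b)) v :
  w =1 y -> cmul w M v = cmul y M v.
Proof. by move=> E; apply/ffunP=> T; rewrite !ffunE; apply: eq_bigr => u _; rewrite E. Qed.

Lemma cprj_cmul a b (dega : 'I_a -> int) (degb : 'I_b -> int) (M : 'M[R]_(a, b)) p z w v :
  hommx dega degb M ->
  cprj p (z - degb v) (cmul w M v) = cmul (fprj dega p z w) M v.
Proof.
move=> hM; apply/ffunP=> T; rewrite !ffunE; case: ifP => Tp; last first.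
  by rewrite big1 // => u _; rewrite ffunE Tp mul0r.
rewrite raddf_sum; apply: eq_bigr => u _ /=; rewrite ffunE Tp.
rewrite mulrC (pihM _ _ (hM u v)) mulrC; congr (pih _ _ * _).
rewrite opprB addrAC; congr (_ - _); by rewrite addrA subrK.
Qed.

Lemma fchain_prj a (deg : 'I_a -> int) p z w : fchain deg p z (fprj deg p z w).
Proof. by move=> u; exact: cprj_chain. Qed.

Lemma cmul_chain a b (dega : 'I_a -> int) (degb : 'I_b -> int) (M : 'M[R]_(a, b)) p z w v :
  hommx dega degb M -> fchain dega p z w -> ischain p (z - degb v) (cmul w M v).
Proof.
move=> hM hw; rewrite /ischain (cprj_cmul _ _ _ _ hM).
by apply: eq_cmul => u; exact: hw.
Qed.

Lemma cin_cmul (P : set R) a b (w : 'I_a -> chain) (M : 'M[R]_(a, b)) v :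
  is_ideal P -> (forall u, cin P (w u)) -> cin P (cmul w M v).
Proof.
move=> idP Pw T; rewrite ffunE; apply: is_ideal_sum => // u _.
by rewrite mulrC; apply: (is_idealM idP); exact: Pw.
Qed.

Lemma cmul_exact a b c (M : 'M[R]_(a, b)) (M' : 'M[R]_(c, a)) (w : 'I_a -> chain) :
  (forall x : 'rV_a, x *m M = 0 -> exists x', x = x' *m M') ->
  (forall v, cmul w M v = 0) -> exists w', forall u, w u = cmul w' M' u.
Proof.
move=> ex wM.
have H T : exists x' : 'rV[R]_c, \row_u w u T = x' *m M'.
  apply: ex; apply/rowP=> v; rewrite [RHS]mxE.
  by have /ffunP/(_ T) := wM v; rewrite cmulE => ->; rewrite ffunE.
have [x xP] := choice H.
exists (fun u => [ffun T => x T 0 u]) => u; apply/ffunP=> T.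
rewrite cmulE; have /rowP/(_ u) := xP T; rewrite mxE => ->; rewrite !mxE.
by apply: eq_bigr => v _; rewrite mxE ffunE.
Qed.

(** The u-th basis element of a free module seen as a 0-chain; v indexes its components. *)
Definition basis_chain a (u v : 'I_a) : chain :=
  [ffun T => ((v == u) && (T == finset.set0))%:R].

Lemma cprj_in (P : set R) p z (c : chain) : is_ideal P -> (forall y x, P x ->
  P (pih y x)) ->
  cin P c -> cin P (cprj p z c).
Proof.
move=> idP hP Pc T; rewrite ffunE; case: ifP => _; last exact: is_ideal0.
exact: hP.
Qed.

Lemma mcoeff0_X i : ('X_i : R)@_0%MM = 0.
Proof. by rewrite mcoeffX mnm1_eq0. Qed.

Lemma mcoeff0_kd (c : chain) T : (kd c T)@_0%MM = 0.
Proof.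
rewrite kdE raddf_sum big1 // => i _ /=.
by rewrite rmorphM /= mcoeff0_X mul0r.
Qed.

End Families.

Lemma homogeneous_pih (k : fieldType) n (I : set {mpoly k[n]}) z x :
  is_ideal I -> homogeneous_ideal I -> I x -> I (pih z x).
Proof. by move=> idI homI Ix; case: z => d /=; [exact: homI|exact: is_ideal0]. Qed.

(** * Degrees in a minimal resolution are detected by Koszul homology *)

Section BettiDegrees.
Variables (k : fieldType) (n : nat) (I : set {mpoly k[n]}).
Variables (F : graded_free_resolution I) (z : int).
Hypotheses (idI : is_ideal I) (homI : homogeneous_ideal I).
Local Notation R := {mpoly k[n]}.
Local Notation chain := {ffun {set 'I_n} -> {mpoly k[n]}}.
Local Notation deg i := (@gfr_deg k n I F i).
Local Notation df i := (gfr_diff F i).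

Lemma gfr_hom i : hommx (deg i.+1) (deg i) (df i).
Proof. by move=> u v m /gfr_diff_deg <-; rewrite addrK. Qed.

Lemma gfr_diffK i : df i.+1 *m df i = 0.
Proof.
apply/row_matrixP=> u; rewrite row_mul row0; apply/(gfr_exactS (g := F)).
by exists (delta_mx 0 u); rewrite rowE.
Qed.

Lemma cmul_gfr_diffK i (y : 'I_(gfr_rank F i.+2) ->
  chain) v : cmul (cmul y (df i.+1)) (df i) v = 0.
Proof.
rewrite cmul_comp gfr_diffK; apply/ffunP=> T; rewrite !ffunE.
by apply: big1 => u _; rewrite mxE mulr0.
Qed.

(* H_p(x_1, ..., x_n; coker (F_(i+1) -> F_i)) vanishes in degree z. *)
Let coker_exact i p := forall w, fchain (deg i) p z w ->
  (exists y, forall v, kd (w v) = cmul y (df i) v) ->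
  exists b y, fchain (deg i) p.+1 z b /\ forall v, w v - kd (b v) = cmul y (df i) v.

(** The cokernel of F_1 -> F_0 is R/I: push the cycle along the augmentation, bound it there, and
    lift the bounding chain to F_0. *)
Lemma coker_exact0 p : exact setT I p z -> coker_exact 0 p.
Proof.
move=> ex w hw [y wy].
have haug : hommx (deg 0) (fun=> 0) (gfr_aug F).
  by move=> u v m; rewrite (ord1 v) subr0 => /gfr_aug_deg.
pose W := cmul w (gfr_aug F) 0.
have Wz : ischain p z W.
  by rewrite -[z]subr0; exact: (cmul_chain 0 haug hw).
have IdW : cin I (kd W).
  move=> T; rewrite kd_cmul (eq_cmul _ _ wy) cmul_comp cmulE mulmxA.
  by apply/gfr_exact0; eexists.
have [b0 [b0z _ Ib0]] := ex W Wz (fun T => Logic.I) IdW.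
have H T : exists x : 'rV[R]_(gfr_rank F 0), I (b0 T - (x *m gfr_aug F) 0 0).
  exact: gfr_aug_surj.
have [x xP] := choice H.
pose b1 u : chain := [ffun T => x T 0 u].
have Ib1 : cin I (b0 - cmul b1 (gfr_aug F) 0).
  move=> T; rewrite !ffunE; have := xP T; rewrite mxE; congr (I (_ - _)).
  by apply: eq_bigr => u _; rewrite ffunE.
(* The lifts are chosen coefficient by coefficient without regard to degree; projecting restores
   homogeneity. *)
pose b := fprj (deg 0) p.+1 z b1.
have Ib : cin I (b0 - cmul b (gfr_aug F) 0).
  rewrite -(cprj_cmul p.+1 z b1 0 haug) subr0 -[X in X - _]b0z -raddfB.
  apply: cprj_in => // y' x'; exact: homogeneous_pih.
exists b.
have H2 T : exists x' : 'rV[R]_(gfr_rank F 1), \row_u (w u - kd (b u)) T = x' *m df 0.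
  apply/gfr_exact0; rewrite -cmulE cmulB.
  have -> : cmul w (gfr_aug F) 0 - cmul (fun u => kd (b u)) (gfr_aug F) 0
      = W - kd b0 + kd (b0 - cmul b (gfr_aug F) 0).
    by rewrite raddfB /= kd_cmul addrA subrK.
  by move: T; apply: cinD => //; exact: cin_kd.
have [x' x'P] := choice H2.
exists (fun u => [ffun T => x' T 0 u]); split; first exact: fchain_prj.
move=> v; apply/ffunP=> T; have /rowP/(_ v) := x'P T; rewrite mxE => ->.
by rewrite cmulE; congr ((_ *m _) _ _); apply/rowP=> u; rewrite mxE ffunE.
Qed.

(** The connecting map: once c is a boundary plus the image of a chain y in F_(i+1), w minus the
    boundary of y maps to 0 in F_i and so comes from F_(i+2). *)
Lemma coker_cycle_lift i p (w : 'I_(gfr_rank F i.+1) -> chain) (c : 'I_(gfr_rank F i) ->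
  chain) :
  coker_exact i p.+1 -> fchain (deg i) p.+1 z c ->
  (forall v, kd (c v) = cmul w (df i) v) ->
  exists b y, fchain (deg i.+1) p.+1 z b /\ forall v, w v - kd (b v) = cmul y (df i.+1) v.
Proof.
move=> ex hc cw.
have [b [y [hb cby]]] := ex c hc (ex_intro _ w cw).
pose y1 := fprj (deg i.+1) p.+1 z y.
have cby1 v : c v - kd (b v) = cmul y1 (df i) v.
  rewrite -(cprj_cmul _ _ _ _ (@gfr_hom i)) -cby raddfB /= hc.
  by rewrite cprj_kd (hb v).
exists y1.
have [||y2 y2P] := cmul_exact (M := df i) (M' := df i.+1) (w := fun v => w v - kd (y1 v)).
- by move=> x /(gfr_exactS (g := F)).
- move=> v; rewrite cmulB -kd_cmul -cw -cby1 raddfB /= kdd subr0 subrr //.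
by exists y2; split=> //; exact: fchain_prj.
Qed.

(** In positive homological degree the free module F_i is acyclic, which provides the chain c for
    [coker_cycle_lift]. *)
Lemma coker_exactS i p : coker_exact i p.+2 -> coker_exact i.+1 p.+1.
Proof.
move=> ex w hw [y wy].
have H v : exists c, ischain p.+2 (z - deg i v) c /\ kd c = cmul w (df i) v.
  have [|||c [cz _ /cin_zero/eqP]] :=
    @koszul_acyclic k n p.+1 (z - deg i v) isT (cmul w (df i) v).
  - by apply: cmul_chain hw; exact: gfr_hom.
  - by [].
  - by apply/cin_zero; rewrite kd_cmul (eq_cmul _ _ wy) cmul_gfr_diffK.
  by rewrite subr_eq0 => /eqP cE; exists c.
have [c cP] := choice H.
by apply: (coker_cycle_lift (c := c) ex) => v; have [] := cP v.
Qed.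

Lemma coker_exact_shift l p : coker_exact 0 (l + p).+1 -> coker_exact l p.+1.
Proof.
by elim: l p => [//|l IH] p; rewrite addSnnS => /IH; exact: coker_exactS.
Qed.

(** Compare constant terms: boundaries and images under a minimal differential have none, whereas
    the basis chain has 1. *)
Lemma minimal_no_unit i (u : 'I_(gfr_rank F i)) (b : 'I_(gfr_rank F i) -> chain) y :
  minimal_resolution F ->
  (forall v, @basis_chain k n _ u v - kd (b v) = cmul y (df i) v) ->
  False.
Proof.
move=> minF /(_ u) /ffunP/(_ finset.set0); rewrite !ffunE !eqxx => /(congr1 (mcoeff 0%MM)).
rewrite mcoeffB mcoeff0_kd subr0 raddf_sum big1 => [|v _]; last first.
  by rewrite /= rmorphM /= minF mulr0.
by rewrite mcoeff1 eqxx => /eqP; rewrite oner_eq0.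
Qed.

(** A basis element in degree z would be a 0-cycle in the cokernel of F_(i+1) -> F_i. Dimension
    shifting makes it a boundary there, which [minimal_no_unit] forbids. *)
Lemma betti_degree i (u : 'I_(gfr_rank F i)) :
  minimal_resolution F -> exact setT I i z -> gfr_deg u <> z.
Proof.
move=> minF ex uz; have := coker_exact0 ex.
have he : fchain (deg i) 0 z (@basis_chain k n _ u).
  move=> v; apply/ischainP; split=> T; rewrite ffunE.
    by rewrite cards_eq0 => /negbTE ->; rewrite andbF.
  case: eqP => [->|_] /=; last exact: ishom0.
  case: eqP => _ /=; last exact: ishom0.
  by move=> m; rewrite msupp1 inE => /eqP ->; rewrite mdeg0 uz subrr subr0.
case: i u {ex} uz he => [|i] u uz he ex.
  have [|b [y [_ E]]] := ex _ he; last exact: (minimal_no_unit minF E).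
  exists (fun=> 0) => v; rewrite (kd_chain0 (he v)); apply/ffunP=> T.
  by rewrite !ffunE big1 // => u' _; rewrite mul0r.
have {}ex : coker_exact i 1 by apply: (@coker_exact_shift i 0); rewrite addn0.
have eE v : cmul (@basis_chain k n _ u) (df i) v = [ffun T =>
  if T == finset.set0 then df i u v else 0].
  apply/ffunP=> T; rewrite !ffunE (bigD1 u) //= ffunE eqxx big1 ?addr0 => [|u' /negbTE u'u].
    by case: eqP; rewrite ?mul1r ?mul0r.
  by rewrite ffunE u'u mul0r.
have H v : exists c, ischain 1 (z - deg i v) c /\
  kd c = cmul (@basis_chain k n _ u) (df i) v.
  have ez : ischain 0 (z - deg i v) (cmul (@basis_chain k n _ u) (df i) v) by apply:
    cmul_chain he; exact: gfr_hom.
  (* The last shift, into homological degree 0, meets the one nonzero class of the free module;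
     minimality makes the entry of degree 0 vanish. *)
  have [z0|z0] := eqVneq (z - deg i v) 0.
    exists 0; rewrite /ischain !raddf0; split=> //; rewrite eE.
    suff -> : df i u v = 0 by apply/ffunP=> T; rewrite !ffunE if_same.
    apply/mpolyP=> m; rewrite mcoeff0.
    have [->|m0] := eqVneq m 0%MM; first exact: minF.
    apply: memN_msupp_eq0; apply: contra m0 => /(gfr_hom (i := i)).
    by rewrite uz z0 -[0]/(0%:Z) => /eqP; rewrite eqz_nat mdeg_eq0.
  have [|||c [cz _ /cin_zero/eqP]] :=
    @koszul_acyclic k n 0 (z - deg i v) z0 (cmul (@basis_chain k n _ u) (df i) v).
  - exact: ez.
  - by [].
  - by apply/cin_zero; exact: kd_chain0 ez.
  by rewrite subr_eq0 => /eqP cE; exists c.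
have [c cP] := choice H.
have [||b [y [_ E]]] := @coker_cycle_lift i 0 (@basis_chain k n _ u) c ex.
- by move=> v; have [] := cP v.
- by move=> v; have [] := cP v.
exact: (minimal_no_unit minF E).
Qed.

End BettiDegrees.

(** * Extension of scalars and the Kuenneth argument *)

Section Morphisms.
Variables (k : fieldType) (n : nat).

Lemma mpoly_rmorph_eq (S : comNzRingType) (f g : {rmorphism {mpoly k[n]} -> S}) :
  (forall c, f c%:MP = g c%:MP) -> (forall i, f 'X_i = g 'X_i) -> f =1 g.
Proof.
move=> fgC fgX p; rewrite [p]mpolyE !raddf_sum; apply: eq_bigr => m _ /=.
rewrite -mul_mpolyC !rmorphM /= fgC; congr (_ * _).
rewrite mpolyXE_id !rmorph_prod; apply: eq_bigr => i _.
by rewrite !rmorphXn /= fgX.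
Qed.

End Morphisms.

Section Embeddings.
Variables (k : fieldType) (r s : nat).
Local Notation A := {mpoly k[r]}.
Local Notation B := {mpoly k[s]}.
Local Notation R := {mpoly k[r + s]}.
Local Notation eX := (@embX k r s).
Local Notation eY := (@embY k r s).

HB.instance Definition _ := GRing.RMorphism.copy eX
  (fun p : A => p \mPo [tuple ('X_(lshift s i) : R) | i < r]).
HB.instance Definition _ := GRing.RMorphism.copy eY
  (fun p : B => p \mPo [tuple ('X_(rshift r j) : R) | j < s]).

Lemma embXC c : eX c%:MP = c%:MP. Proof. exact: comp_mpolyC. Qed.
Lemma embYC c : eY c%:MP = c%:MP. Proof. exact: comp_mpolyC. Qed.

Lemma embX_X i : eX 'X_i = 'X_(lshift s i).
Proof. by rewrite /embX comp_mpolyXU -tnth_nth tnth_mktuple. Qed.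

Lemma embY_X i : eY 'X_i = 'X_(rshift r i).
Proof. by rewrite /embY comp_mpolyXU -tnth_nth tnth_mktuple. Qed.

Lemma embXZ c p : eX (c *: p) = c *: eX p.
Proof. exact: comp_mpolyZ. Qed.

Lemma embYZ c p : eY (c *: p) = c *: eY p.
Proof. exact: comp_mpolyZ. Qed.

Definition lmnm (m : 'X_{1..r}) : 'X_{1..r + s} :=
  [multinom if split i is inl a then m a else 0%N | i < r + s].
Definition rmnm (m : 'X_{1..s}) : 'X_{1..r + s} :=
  [multinom if split i is inr a then m a else 0%N | i < r + s].

Lemma split_lshift (a : 'I_r) : split (lshift s a) = inl a.
Proof. by rewrite -[lshift s a]/(unsplit (inl a)) unsplitK. Qed.
Lemma split_rshift (a : 'I_s) : split (rshift r a) = inr a.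
Proof. by rewrite -[rshift r a]/(unsplit (inr a)) unsplitK. Qed.

Lemma embX_mnm m : eX 'X_[m] = 'X_[lmnm m].
Proof.
rewrite mpolyXE_id rmorph_prod [RHS]mpolyXE_id big_split_ord /=.
rewrite [X in _ = _ * X]big1 ?mulr1 => [|j _]; last first.
  by rewrite mnmE split_rshift expr0.
by apply: eq_bigr => i _; rewrite rmorphXn /= embX_X mnmE split_lshift.
Qed.

Lemma embY_mnm m : eY 'X_[m] = 'X_[rmnm m].
Proof.
rewrite mpolyXE_id rmorph_prod [RHS]mpolyXE_id big_split_ord /=.
rewrite [X in _ = X * _]big1 ?mul1r => [|j _]; last first.
  by rewrite mnmE split_lshift expr0.
by apply: eq_bigr => i _; rewrite rmorphXn /= embY_X mnmE split_rshift.
Qed.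

Lemma mdeg_lmnm m : mdeg (lmnm m) = mdeg m.
Proof.
rewrite !mdegE big_split_ord /= [X in (_ + X)%N]big1 ?addn0 => [|j _]; last first.
  by rewrite mnmE split_rshift.
by apply: eq_bigr => i _; rewrite mnmE split_lshift.
Qed.

Lemma mdeg_rmnm m : mdeg (rmnm m) = mdeg m.
Proof.
rewrite !mdegE big_split_ord /= [X in (X + _)%N]big1 ?add0n => [|j _]; last first.
  by rewrite mnmE split_lshift.
by apply: eq_bigr => i _; rewrite mnmE split_rshift.
Qed.

Lemma pihZX n z c (m : 'X_{1..n}) :
  pih z (c *: 'X_[m]) = if (mdeg m)%:Z == z then c *: 'X_[m] else 0 :> {mpoly k[n]}.
Proof.
apply/mpolyP=> m'; rewrite mcoeff_pih mcoeffZ mcoeffX.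
case: (eqVneq m m') => [->|ne]; rewrite ?mulr0.
  by case: ifP => _; rewrite ?mcoeffZ ?mcoeffX ?eqxx ?mcoeff0.
by rewrite if_same; case: ifP => _; rewrite ?mcoeffZ ?mcoeffX ?(negbTE ne) ?mulr0 ?mcoeff0.
Qed.

Lemma embXE p : eX p = \sum_(m <- msupp p) p@_m *: 'X_[lmnm m].
Proof.
rewrite {1}[p]mpolyE (raddf_sum eX); apply: eq_bigr => m _ /=.
by rewrite embXZ embX_mnm.
Qed.

Lemma pih_embX z p : pih z (eX p) = eX (pih z p).
Proof.
rewrite embXE (raddf_sum (pih z)) [in RHS](mpolyE p) (raddf_sum (pih z)) (raddf_sum eX).
apply: eq_bigr => m _ /=; rewrite !pihZX mdeg_lmnm.
by case: ifP => _; rewrite ?raddf0 // embXZ embX_mnm.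
Qed.

Lemma embYE p : eY p = \sum_(m <- msupp p) p@_m *: 'X_[rmnm m].
Proof.
rewrite {1}[p]mpolyE (raddf_sum eY); apply: eq_bigr => m _ /=.
by rewrite embYZ embY_mnm.
Qed.

Lemma pih_embY z p : pih z (eY p) = eY (pih z p).
Proof.
rewrite embYE (raddf_sum (pih z)) [in RHS](mpolyE p) (raddf_sum (pih z)) (raddf_sum eY).
apply: eq_bigr => m _ /=; rewrite !pihZX mdeg_rmnm.
by case: ifP => _; rewrite ?raddf0 // embYZ embY_mnm.
Qed.

(* R = A[Y]: [ycoef m p] is the coefficient in A of the monomial Y^m in p. *)
Definition ypoly : R -> {mpoly A[s]} :=
  mmap (@mpolyC s A \o @mpolyC r k)
    (fun i => match split i with inl a => ('X_a)%:MP | inr b => 'X_b end).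
HB.instance Definition _ := GRing.RMorphism.on ypoly.

Definition ycoef m p : A := (ypoly p)@_m.

Lemma ycoef_is_zmod_morphism m : zmod_morphism (ycoef m).
Proof. by move=> p q; rewrite /ycoef raddfB mcoeffB. Qed.
HB.instance Definition _ m :=
  GRing.isZmodMorphism.Build R A (ycoef m) (ycoef_is_zmod_morphism m).

Lemma ypolyC c : ypoly c%:MP = c%:MP%:MP. Proof. exact: mmapC. Qed.

Lemma ypolyX i : ypoly 'X_i = match split i with inl a => ('X_a)%:MP | inr b => 'X_b end.
Proof. by rewrite /ypoly mmapX mmap1U. Qed.

Lemma ypoly_embX a : ypoly (eX a) = a%:MP.
Proof.
apply: (mpoly_rmorph_eq (f := ypoly \o eX) (g := @mpolyC s A)) => [c|i] /=.
  by rewrite embXC ypolyC.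
by rewrite embX_X ypolyX split_lshift.
Qed.

Lemma ypoly_embY b : ypoly (eY b) = map_mpoly (@mpolyC r k) b.
Proof.
apply: (mpoly_rmorph_eq (f := ypoly \o eY) (g := map_mpoly (@mpolyC r k))) => [c|i] /=.
  by rewrite embYC ypolyC map_mpolyC.
by rewrite embY_X ypolyX split_rshift map_mpolyX.
Qed.

Lemma ycoefM m a p : ycoef m (eX a * p) = a * ycoef m p.
Proof. by rewrite /ycoef rmorphM /= ypoly_embX mcoeffCM. Qed.

Lemma ycoef_embXY m a b : ycoef m (eX a * eY b) = b@_m *: a.
Proof.
by rewrite ycoefM /ycoef ypoly_embY mcoeff_map_mpoly mulrC mul_mpolyC.
Qed.

Lemma ycoef0_embX a : ycoef 0%MM (eX a) = a.
Proof. by rewrite /ycoef ypoly_embX mcoeffC eqxx mulr1. Qed.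

Lemma ycoefE p : p = \sum_(m <- msupp (ypoly p)) eX (ycoef m p) * eY 'X_[m].
Proof.
(* The inverse of [ypoly]. *)
pose psi := mmap eX (fun b => 'X_(rshift r b) : R).
have psiK q : psi (ypoly q) = q.
  apply: (mpoly_rmorph_eq (f := psi \o ypoly) (g := idfun)) => [c|i] /=.
    by rewrite ypolyC /psi mmapC /= embXC.
  rewrite ypolyX /psi; case: (splitP i) => j ij.
    by rewrite mmapC /= embX_X; congr 'X_(_); apply: val_inj.
  by rewrite mmapX mmap1U; congr 'X_(_); apply: val_inj.
rewrite -{1}[p]psiK /psi /mmap; apply: eq_bigr => m _; congr (_ * _).
by rewrite mpolyXE_id rmorph_prod; apply: eq_bigr => i _; rewrite rmorphXn /= embY_X.
Qed.

Definition extX (P : set A) : set R := ideal_span (eX @` P).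
Definition extY (J : set B) : set R := ideal_span (eY @` J).

Lemma is_ideal_span (S : comNzRingType) (E : set S) : is_ideal (ideal_span E).
Proof.
split; first by exists [::]; rewrite big_nil.
- move=> _ _ [t [tE ->]] [t' [t'E ->]]; exists (t ++ t'); rewrite big_cat; split=> // z.
  by rewrite mem_cat => /orP[/tE|/t'E].
- move=> a _ [t [tE ->]]; exists [seq (a * z.1, z.2) | z <- t]; split.
    by move=> z /mapP[y /tE Ey ->].
  by rewrite big_map mulr_sumr; apply: eq_bigr => z _; rewrite mulrA.
Qed.

Lemma sub_ideal_span (S : comNzRingType) (E : set S) : E `<=` ideal_span E.
Proof.
move=> x Ex; exists [:: (1, x)]; rewrite big_seq1 mul1r; split=> // z.
by rewrite inE => /eqP ->.
Qed.

Lemma ideal_span_le (S : comNzRingType) (E P : set S) :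
  is_ideal P -> E `<=` P -> ideal_span E `<=` P.
Proof.
move=> idP EP _ [t [tE ->]]; rewrite big_seq; elim/big_rec: _ => [|z x /tE Ez Px].
  exact: is_ideal0.
by apply: (is_idealD idP) => //; apply: (is_idealM idP); exact: EP.
Qed.

Lemma is_ideal_extX P : is_ideal (extX P). Proof. exact: is_ideal_span. Qed.
Lemma is_ideal_extY J : is_ideal (extY J). Proof. exact: is_ideal_span. Qed.

Lemma extX_embX P a : P a -> extX P (eX a).
Proof. by move=> Pa; apply: sub_ideal_span; exists a. Qed.

Lemma extY_embY J b : J b -> extY J (eY b).
Proof. by move=> Jb; apply: sub_ideal_span; exists b. Qed.

(** R is free over A on the monomials in Y. *)
Lemma extXP P p : is_ideal P -> extX P p <-> forall m, P (ycoef m p).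
Proof.
move=> idP; split=> [pP m|Pp].
  suff : extX P `<=` [set p | forall m, P (ycoef m p)] by move/(_ p pP).
  move=> _ [t [tE ->]] m'; rewrite raddf_sum big_seq.
  apply: is_ideal_sum => // z /tE [a Pa <-] /=.
  by rewrite mulrC ycoefM mulrC; exact: is_idealM.
rewrite [p]ycoefE; apply: is_ideal_sum => [|m _]; first exact: is_ideal_extX.
by rewrite mulrC; apply: (is_idealM (is_ideal_extX P)); exact: extX_embX.
Qed.

Lemma extXS P Q : P `<=` Q -> extX P `<=` extX Q.
Proof.
move=> PQ; apply: ideal_span_le; first exact: is_ideal_extX.
by move=> _ [a /PQ Qa <-]; exact: extX_embX.
Qed.

Lemma extYS P Q : P `<=` Q -> extY P `<=` extY Q.
Proof.
move=> PQ; apply: ideal_span_le; first exact: is_ideal_extY.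
by move=> _ [a /PQ Qa <-]; exact: extY_embY.
Qed.

Lemma pih_span n (E : set {mpoly k[n]}) z :
  (forall d x, E x -> ideal_span E (pih d x)) ->
  forall x, ideal_span E x -> ideal_span E (pih z x).
Proof.
move=> hE _ [t [tE ->]]; rewrite raddf_sum big_seq.
apply: is_ideal_sum => [|y /tE Ey /=]; first exact: is_ideal_span.
rewrite [y.1]pihom_sum mulr_suml raddf_sum.
apply: is_ideal_sum => [|d _ /=]; first exact: is_ideal_span.
rewrite (pihM _ _ (@pihP _ _ _ _)).
by apply: (is_idealM (is_ideal_span _)); exact: hE.
Qed.

Lemma pih_extX P z x : (forall y d, P y -> P (pih d y)) -> extX P x -> extX P (pih z x).
Proof.
move=> hP; apply: pih_span => d _ [a Pa <-].
by rewrite pih_embX; apply: extX_embX; exact: hP.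
Qed.

Lemma pih_extY J z x : (forall y d, J y -> J (pih d y)) -> extY J x -> extY J (pih z x).
Proof.
move=> hJ; apply: pih_span => d _ [a Ja <-].
by rewrite pih_embY; apply: extY_embY; exact: hJ.
Qed.

End Embeddings.

Arguments is_ideal_extX {k r s} P.
Arguments is_ideal_extY {k r s} J.
Arguments extXP {k r s P p}.

(** * Base change of Koszul homology from A to R *)

Section BaseChange.
Variables (k : fieldType) (r s : nat).
Local Notation A := {mpoly k[r]}.
Local Notation B := {mpoly k[s]}.
Local Notation R := {mpoly k[r + s]}.
Local Notation eX := (@embX k r s).
Local Notation eY := (@embY k r s).
Local Notation extX := (@extX k r s).
Local Notation chainA := {ffun {set 'I_r} -> {mpoly k[r]}}.
Local Notation chain := {ffun {set 'I_(r + s)} -> {mpoly k[r + s]}}.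

Lemma qdiv_embX (j : 'I_s) a (x : R) :
  qdiv (rshift r j) (eX a * x) = eX a * qdiv (rshift r j) x.
Proof.
have H (m : 'X_{1..r}) (y : R) : qdiv (rshift r j) (eX 'X_[m] * y) = eX 'X_[m] * qdiv
  (rshift r j) y.
  rewrite mpolyXE_id rmorph_prod /=; elim/big_rec: _ y => [|i e _ IH] y;
    first by rewrite !mul1r.
  rewrite rmorphXn /= embX_X -!mulrA.
  elim: (m i) => [|l IHl]; first by rewrite expr0 !mul1r.
  by rewrite exprS -!mulrA qdivXj ?IHl // eq_rlshift.
rewrite embXE mulr_suml raddf_sum mulr_suml; apply: eq_bigr => m _ /=.
by rewrite -embX_mnm -!scalerAl qdivZ H.
Qed.

Lemma qdiv_extX P (j : 'I_s) x : extX P x -> extX P (qdiv (rshift r j) x).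
Proof.
case=> t [tE ->]; rewrite raddf_sum big_seq; apply: is_ideal_sum;
  first exact: is_ideal_extX.
move=> z /tE [a Pa <-] /=; rewrite mulrC qdiv_embX mulrC.
by apply: (is_idealM (is_ideal_extX P)); exact: extX_embX.
Qed.

Definition preimX (T : {set 'I_(r + s)}) : {set 'I_r} := finset (fun a => lshift s a \in T).

Definition Yfree (T : {set 'I_(r + s)}) := [forall j : 'I_s, rshift r j \notin T].

(** The Koszul complex of A inside that of R: only sets of X variables, only coefficients from A. *)
Definition chX (u : chainA) : chain := [ffun T => if Yfree T then eX (u (preimX T)) else 0].

Lemma chX_is_zmod_morphism : zmod_morphism chX.
Proof. by move=> u v; apply/ffunP=> T; rewrite !ffunE; case: ifP => _;
  rewrite ?subr0 ?raddfB. Qed.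
HB.instance Definition _ := GRing.isZmodMorphism.Build chainA chain chX
  chX_is_zmod_morphism.

Lemma Yfree_imset T : Yfree T -> [set lshift s a | a in preimX T]%SET = T.
Proof.
move=> /forallP TY; apply/setP=> i; apply/imsetP/idP => [[a aT ->]|iT].
  by rewrite inE in aT.
case: (split_ordP i) iT => [a ->|b ->] iT; first by exists a; rewrite ?inE.
by have := TY b; rewrite iT.
Qed.

Lemma card_preimX T : Yfree T -> #|preimX T| = #|T|.
Proof. by move=> TY; rewrite -{2}(Yfree_imset TY) card_imset //; exact: lshift_inj. Qed.

Lemma preimX_imset (S : {set 'I_r}) :
  Yfree [set lshift s a | a in S]%SET /\ preimX [set lshift s a | a in S]%SET = S.
Proof.
split; first by apply/forallP=> j; apply/imsetP=> -[a _ /eqP]; rewrite eq_rlshift.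
by apply/setP=> a; rewrite inE mem_imset //; exact: lshift_inj.
Qed.

Lemma ksign_preimX a T : Yfree T -> ksign (lshift s a) T = ksign a (preimX T).
Proof.
move=> TY; rewrite /ksign -[RHS](card_imset _ (@lshift_inj r s)).
congr #|pred_of_set _|; apply/setP=> i; rewrite inE; apply/andP/imsetP.
  move=> [iT ia]; case: (split_ordP i) iT ia => [b ->|b ->] iT ia.
    by exists b => //; rewrite !inE iT.
  by have /forallP/(_ b) := TY; rewrite iT.
by move=> [b]; rewrite !inE => /andP[bT ba] ->.
Qed.

Lemma kd_chX u : kd (chX u) = chX (kd u).
Proof.
apply/ffunP=> T; rewrite kdE big_split_ord /= [X in _ + X]big1 ?addr0 => [|j _]; last first.
  rewrite !ffunE; case: ifP => _; rewrite ?mulr0 //.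
  case: ifP => [/forallP/(_ j)|_]; last by rewrite !mulr0.
  by rewrite !inE eqxx.
rewrite ffunE; case: ifPn => TY; last first.
  apply: big1 => a _; rewrite !ffunE; case: ifP => _; rewrite ?mulr0 //.
  rewrite ifF ?mulr0 //; apply: contraNF TY => /forallP H.
  by apply/forallP=> j; apply: contra (H j) => jT; rewrite !inE jT orbT.
rewrite kdE (raddf_sum eX); apply: eq_bigr => a _ /=.
rewrite rmorphM /= embX_X !ffunE inE; case: ifP => aT; first by rewrite raddf0.
rewrite ifT; last first.
  apply/forallP=> j; rewrite !inE negb_or (forallP TY) andbT.
  by rewrite eq_rlshift.
have -> : preimX (lshift s a |: T)%SET = (a |: preimX T)%SET.
  by apply/setP=> b; rewrite !inE (inj_eq (@lshift_inj r s)).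
rewrite ksign_preimX //.
rewrite (raddfMsign eX).
by [].
Qed.

Lemma ischain_chX p z u : ischain p z (chX u) <-> ischain p z u.
Proof.
have E : cprj p z (chX u) = chX (cprj p z u).
  apply/ffunP=> T; rewrite !ffunE; case: ifP => Tp; case: ifP => TY; rewrite ?raddf0 //.
    by rewrite card_preimX // Tp pih_embX.
  by rewrite card_preimX // Tp raddf0.
rewrite /ischain E; split=> [/ffunP H|->//]; apply/ffunP=> S.
have [SY SE] := preimX_imset S.
have := H [set lshift s a | a in S]%SET; rewrite !ffunE SY SE.
by move/(congr1 (ycoef 0%MM)); rewrite !ycoef0_embX.
Qed.

Lemma cin_chX P u : is_ideal P -> cin (extX P) (chX u) <-> cin P u.
Proof.
move=> idP; split=> [H S|H T].
  have [SY SE] := preimX_imset S.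
  have := H [set lshift s a | a in S]%SET; rewrite ffunE SY SE => /(extXP idP)/(_ 0%MM).
  by rewrite ycoef0_embX.
rewrite ffunE; case: ifP => _; last exact: is_ideal0 (is_ideal_extX P).
exact: extX_embX.
Qed.

Lemma Yfree_embX (x : R) :
  (forall j : 'I_s, forall m, m \in msupp x -> m (rshift r j) = 0%N) ->
    x = eX (ycoef 0%MM x).
Proof.
move=> xY; suff [y ->] : exists y, x = eX y by rewrite ycoef0_embX.
exists (\sum_(m <- msupp x) x@_m *: 'X_[[multinom m (lshift s i) | i < r]]).
rewrite (raddf_sum eX) {1}[x]mpolyE big_seq [RHS]big_seq; apply: eq_bigr => m mx /=.
rewrite embXZ embX_mnm; congr (_ *: 'X_[_]); apply/mnmP=> i; rewrite mnmE.
case: (split_ordP i) => [a ->|b ->]; rewrite ?split_lshift ?split_rshift ?mnmE //.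
exact: xY.
Qed.

(** The ideals P R and Q R are stable under [qdiv] along Y, so [koszul_reduce] moves the cycle into
    the Koszul complex of A. *)
Lemma exact_extX P Q p z : is_ideal P -> is_ideal Q ->
  exact P Q p z -> exact (extX P) (extX Q) p z.
Proof.
move=> idP idQ ex c cz Pc Qdc.
have [||b [c' [[bz Pb] [c'z Pc'] Qdc' Qcc' L0]]] :=
  @koszul_reduce _ _ (extX P) (extX Q) [seq rshift r j | j <- enum 'I_s] p z c
    (is_ideal_extX P) (is_ideal_extX Q) _ _ cz Pc Qdc.
- by move=> _ x /mapP[j _ ->]; exact: qdiv_extX.
- by move=> _ x /mapP[j _ ->]; exact: qdiv_extX.
have jL j : rshift r j \in [seq rshift r j | j <- enum 'I_s] by rewrite map_f ?mem_enum.
pose u : chainA := [ffun S : {set 'I_r} => ycoef 0%MM (c' [set lshift s a | a in S]%SET)].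
have c'u : c' = chX u.
  apply/ffunP=> T; rewrite ffunE; case: ifPn => [TY|].
    rewrite ffunE Yfree_imset // -Yfree_embX // => j m.
    by apply: (L0 _ _ (jL j)).2.
  rewrite negb_forall => /existsP[j]; rewrite negbK => jT.
  exact: (L0 _ _ (jL j)).1 jT.
have [|||b1 [b1z Pb1 Qb1]] := ex u.
- by apply/ischain_chX; rewrite -c'u.
- by apply/cin_chX; rewrite -?c'u.
- by apply/cin_chX => //; rewrite -kd_chX -c'u.
exists (b + chX b1); split.
- by apply: ischainD => //; apply/ischain_chX.
- by apply: cinD => //; [exact: is_ideal_extX|apply/cin_chX].
rewrite raddfD /= kd_chX opprD addrA.
have -> : c - kd b - chX (kd b1) = (c - kd b - c') + chX (u - kd b1).
  by rewrite raddfB /= -c'u addrA subrK.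
by apply: cinD => //; [exact: is_ideal_extX|apply/cin_chX].
Qed.

(* Writing a family with entries in P R as sum_(i < t) p_i g_i with t minimal
   makes the p_i linearly independent over k modulo Q. *)
Lemma tensor_decomposition P Q a (w : 'I_a -> R) :
  is_ideal P -> is_ideal Q -> (forall u, extX P (w u)) ->
  exists t (p : 'I_t -> A) (g : 'I_t -> 'rV[B]_a),
  [/\ forall i, P (p i),
      forall u, extX Q (w u - \sum_i eX (p i) * eY (g i 0 u)) &
      forall l : 'I_t -> k, Q (\sum_i l i *: p i) -> forall i, l i = 0].
Proof.
move=> idP idQ Pw.
pose dec t := exists (p : 'I_t -> A) (g : 'I_t -> 'rV[B]_a),
  (forall i, P (p i)) /\ forall u, extX Q (w u - \sum_i eX (p i) * eY (g i 0 u)).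
have ex : exists t, `[< dec t >].
  (* Some decomposition exists: expand every entry in the monomials in Y. *)
  pose L : seq (A * 'rV[B]_a) :=
    flatten [seq [seq (ycoef m (w u), 'X_[m] *: delta_mx 0 u) | m <- msupp (ypoly (w u))]
      | u <- enum 'I_a].
  pose x0 : A * 'rV[B]_a := (0, 0).
  exists (size L); apply/asboolP.
  exists (fun i => (nth x0 L i).1), (fun i => (nth x0 L i).2); split=> [i|u].
    have /flatten_mapP[u _ /mapP[m _ ->]] := mem_nth x0 (ltn_ord i).
    exact: (extXP idP).1.
  rewrite -(big_mkord xpredT (fun i => eX (nth x0 L i).1 * eY ((nth x0 L i).2 0 u))).
  rewrite -(big_nth x0 xpredT (fun x =>
    eX x.1 * eY (x.2 0 u))) big_flatten big_map big_enum /=.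
  rewrite (bigD1 u) //= [X in _ - (_ + X)]big1 ?addr0 => [|v vu]; last first.
    rewrite big_map big1 // => m _ /=; rewrite !mxE eqxx eq_sym (negbTE vu).
    by rewrite mulr0 raddf0 mulr0.
  rewrite big_map /= {1}[w u]ycoefE.
  rewrite [X in X - _](eq_bigr (fun m =>
    eX (ycoef m (w u)) * eY (('X_[m] *: delta_mx 0 u : 'rV[B]_a) 0 u))).
    by rewrite subrr; exact: is_ideal0 (is_ideal_extX Q).
  by move=> m _; rewrite !mxE !eqxx mulr1.
have [t /asboolP [p [g [Pp Qw]]] tmin] := ex_minnP ex.
exists t, p, g; split=> // l Ql i0; apply: contrapT => /eqP li0.
case: t p g Pp Qw tmin l Ql i0 li0 => [|t] p g Pp Qw tmin l Ql i0 li0;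
  first by case: i0 li0.
suff : dec t by move/asboolP/tmin; rewrite ltnn.
exists (p \o lift i0), (fun i => g (lift i0 i) - (l (lift i0 i) / l i0)%:MP *: g i0).
split=> [i|u]; first exact: Pp.
(* The relation expresses p_i0 through the others modulo Q; its factor g_i0 is redistributed, which
   saves a term. *)
have Qp : Q (p i0 + \sum_i (l (lift i0 i) / l i0) *: p (lift i0 i)).
  have -> : p i0 + \sum_i (l (lift i0 i) / l i0) *: p (lift i0 i) = (l i0)^-1%:MP * \sum_i
    l i *: p i.
    rewrite mul_mpolyC (bigD1_ord i0) //= scalerDr scalerA mulVf // scale1r; congr (_ + _).
    by rewrite scaler_sumr; apply: eq_bigr => i _; rewrite scalerA mulrC.
  exact: is_idealM.
set D := _ - _.
have -> : D = (w u - \sum_i eX (p i) * eY (g i 0 u))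
   + eY (g i0 0 u) * eX (p i0 + \sum_i (l (lift i0 i) / l i0) *: p (lift i0 i)).
  rewrite /D (eq_bigr (fun i => eX (p (lift i0 i)) * eY (g (lift i0 i) 0 u)
      - eX ((l (lift i0 i) / l i0) *: p (lift i0 i)) * eY (g i0 0 u))) => [|i _].
    have -> : eY (g i0 0 u) * eX (p i0 + \sum_i (l (lift i0 i) / l i0) *: p (lift i0 i)) =
        eX (p i0) * eY (g i0 0 u)
        + \sum_i eX ((l (lift i0 i) / l i0) *: p (lift i0 i)) * eY (g i0 0 u).
      rewrite (raddfD eX) (raddf_sum eX) mulrC mulrDl; congr (_ + _).
      by rewrite [LHS]mulr_suml.
    rewrite sumrB (bigD1_ord i0) //= opprB opprD -addrA.
    by congr (_ + _); rewrite addrACA addNr add0r addrC.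
  rewrite /= !mxE rmorphB rmorphM /= embYC mulrBr embXZ -mul_mpolyC.
  by congr (_ - _); rewrite mulrCA mulrA.
apply: (is_idealD (is_ideal_extX Q)) => //.
by apply: (is_idealM (is_ideal_extX Q)); exact: extX_embX.
Qed.

End BaseChange.

(** * Flatness over k and dimension shifting along a resolution of B/J *)

Section Kunneth.
Variables (k : fieldType) (r s : nat).
Local Notation B := {mpoly k[s]}.
Local Notation R := {mpoly k[r + s]}.
Local Notation eX := (@embX k r s).
Local Notation eY := (@embY k r s).
Local Notation extX := (@extX k r s).
Local Notation chain := {ffun {set 'I_(r + s)} -> {mpoly k[r + s]}}.
Variables (P Q : set {mpoly k[r]}).
Hypotheses (idP : is_ideal P) (idQ : is_ideal Q).

(** Write w as a sum of p_i g_i with the p_i independent modulo Q: then every g_i is itself a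
    relation of D, and exactness over B applies to each. *)
Lemma flatness a b c (D : 'M[B]_(a, b)) (D' : 'M[B]_(c, a)) (w : 'I_a -> R) :
  (forall g : 'rV_a, g *m D = 0 -> exists g', g = g' *m D') ->
  (forall u, extX P (w u)) ->
  (forall v, extX Q (\sum_u w u * eY (D u v))) ->
  exists w' : 'I_c -> R, (forall u, extX P (w' u)) /\
    forall u, extX Q (w u - \sum_v w' v * eY (D' v u)).
Proof.
move=> ex Pw Qw; have [t [p [g [Pp Qd indep]]]] := tensor_decomposition idP idQ Pw.
have idxQ := is_ideal_extX (s := s) Q.
have gD i : g i *m D = 0.
  apply/rowP=> v; apply/mpolyP=> m; rewrite [in RHS]mxE mcoeff0.
  apply: (indep (fun i => ((g i *m D) 0 v)@_m)).
  have : extX Q (\sum_j eX (p j) * eY ((g j *m D) 0 v)).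
    have -> : \sum_j eX (p j) * eY ((g j *m D) 0 v) = \sum_u w u * eY (D u v)
        - \sum_u eY (D u v) * (w u - \sum_j eX (p j) * eY (g j 0 u)).
      rewrite -sumrB (eq_bigr (fun j => \sum_u eX (p j) * eY (g j 0 u) * eY (D u v))).
        rewrite exchange_big; apply: eq_bigr => u _ /=.
        by rewrite mulrBr mulrC opprB addrC subrK mulr_sumr; apply: eq_bigr => j _;
          rewrite mulrC.
      move=> j _; rewrite mxE (raddf_sum eY) mulr_sumr; apply: eq_bigr => u _ /=.
      by rewrite rmorphM mulrA.
    apply: is_idealB => //; apply: is_ideal_sum => // u _.
    exact: is_idealM.
  move/(extXP idQ)/(_ m); rewrite raddf_sum /=.
  by under eq_bigr do rewrite ycoef_embXY.
have [g' g'P] := choice (fun i => ex _ (gD i)).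
exists (fun v => \sum_i eX (p i) * eY (g' i 0 v)); split=> u.
  apply: is_ideal_sum => [|i _]; first exact: is_ideal_extX.
  by rewrite mulrC; apply: (is_idealM (is_ideal_extX P)); exact: extX_embX.
suff -> : \sum_v (\sum_i eX (p i) * eY (g' i 0 v)) * eY (D' v u) = \sum_i eX (p i) * eY (g
  i 0 u) by [].
under eq_bigr do rewrite mulr_suml.
rewrite exchange_big; apply: eq_bigr => i _ /=.
rewrite [g i in RHS]g'P mxE (raddf_sum eY) mulr_sumr; apply: eq_bigr => v _ /=.
by rewrite rmorphM mulrA.
Qed.

Variables (J : set {mpoly k[s]}) (G : graded_free_resolution J).
Hypotheses (homP : homogeneous_ideal P) (homQ : homogeneous_ideal Q).
Local Notation deg i := (@gfr_deg k s J G i).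
Local Notation df i := (map_mx eY (gfr_diff G i)).

Let homdf i : hommx (deg i.+1) (deg i) (df i).
Proof.
move=> u v; rewrite mxE; apply: ishom_pih; rewrite pih_embY pih_id //.
exact: gfr_hom.
Qed.

Let idxQ := is_ideal_extX (s := s) Q.

Let idxP := is_ideal_extX (s := s) P.
Let pih_xP z x : extX P x -> extX P (pih z x).
Proof. by apply: pih_extX => y d; exact: homogeneous_pih. Qed.

Let pih_xQ z x : extX Q x -> extX Q (pih z x).
Proof. by apply: pih_extX => y d; exact: homogeneous_pih. Qed.

Let dfK i (y : 'I_(gfr_rank G i.+2) -> chain) v : cmul (cmul y (df i.+1)) (df i) v = 0.
Proof.
rewrite cmul_comp -map_mxM gfr_diffK; apply/ffunP=> T; rewrite !ffunE.
by apply: big1 => u _; rewrite !mxE raddf0 mulr0.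
Qed.

Lemma cmul_flat i (w : 'I_(gfr_rank G i.+1) -> chain) :
  (forall u, cin (extX P) (w u)) -> (forall v, cin (extX Q) (cmul w (df i) v)) ->
  exists y, (forall u, cin (extX P) (y u)) /\
    forall u, cin (extX Q) (w u - cmul y (df i.+1) u).
Proof.
move=> Pw Qw.
have H T : exists x : 'I_(gfr_rank G i.+2) -> R, (forall u, extX P (x u)) /\
    forall u, extX Q (w u T - \sum_v x v * eY (gfr_diff G i.+1 v u)).
  apply: (flatness (D := gfr_diff G i)) => [g gD|u|v].
  - exact/(gfr_exactS (g := G)).
  - exact: Pw.
  - by have := Qw v T; rewrite ffunE; under eq_bigr do rewrite mxE.
have [x xP] := choice H.
exists (fun u => [ffun T => x T u]); split=> u T; first by rewrite ffunE; have [] := xP T.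
rewrite !ffunE; have := (xP T).2 u; congr (extX Q (_ - _)).
by apply: eq_bigr => v _; rewrite mxE ffunE.
Qed.

(* Dimension shifting along G: M (x) coker (G_(i+1) -> G_i) with M = P/Q. *)
Lemma kunneth_shift p : forall i z (w : 'I_(gfr_rank G i) -> chain),
  (forall q l (u : 'I_(gfr_rank G l)), (q <= p)%N -> l = (i + q)%N ->
     exact P Q (p - q) (z - deg l u)) ->
  fchain (deg i) p z w -> (forall u, cin (extX P) (w u)) ->
  (exists2 y, forall u, cin (extX P) (y u) & forall v,
    cin (extX Q) (kd (w v) - cmul y (df i) v)) ->
  exists b y, [/\ fchain (deg i) p.+1 z b, forall u, cin (extX P) (b u),
    forall u, cin (extX P) (y u) &
    forall v, cin (extX Q) (w v - kd (b v) - cmul y (df i) v)].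
Proof.
elim: p => [|p IH] i z w ex hw Pw [y Py Qdw].
  have H v : exists b, [/\ ischain 1 (z - deg i v) b,
    cin (extX P) b & cin (extX Q) (w v - kd b)].
    apply: (exact_extX idP idQ); [|exact: hw|exact: Pw|].
      by apply: (ex 0%N); rewrite ?addn0.
    by rewrite (kd_chain0 (hw v)); exact: cin0.
  have [b bP] := choice H.
  exists b, (fun=> 0); split=> [u|u|u|v]; try by case: (bP u).
    exact: cin0.
  have -> : cmul (fun=> 0) (df i) v = 0.
    by apply/ffunP=> T; rewrite !ffunE big1 // => u _; rewrite mul0r.
  by rewrite subr0; case: (bP v).
(* The correcting chain y is given without a degree; its part in degree z corrects as well, since w
   is homogeneous. *)
pose y1 := fprj (deg i.+1) p z y.
have Py1 u : cin (extX P) (y1 u) by apply: cprj_in.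
have Qdw1 v : cin (extX Q) (kd (w v) - cmul y1 (df i) v).
  rewrite -(cprj_cmul p z y v (@homdf i)) -[w v]hw -cprj_kd -raddfB /=.
  apply: cprj_in; [exact: idxQ|move=> ? ?; exact: pih_xQ|exact: Qdw].
(* The boundary of y1 maps into Q R, so by flatness y1 is a cycle modulo the image of G_(i+2), as
   the induction hypothesis requires. *)
have [||y2 [Py2 Qy2]] := @cmul_flat i (fun u => kd (y1 u)).
- by move=> u; exact: cin_kd.
- move=> v; rewrite -kd_cmul.
  have -> : kd (cmul y1 (df i) v) = - kd (kd (w v) - cmul y1 (df i) v).
    by rewrite raddfB /= kdd sub0r opprK.
  by apply: cinN => //; exact: cin_kd.
have [||||b1 [y3 [hb1 Pb1 Py3 Q1]]] := IH i.+1 z y1.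
- by move=> q l u qp lE; apply: (ex q.+1) => //; rewrite addnS -addSn.
- exact: fchain_prj.
- exact: Py1.
- by exists y2.
(* The correction makes w a true cycle with coefficients in M (x) G_i, a sum of shifted copies of P
   R / Q R, where the hypothesis for q = 0 applies. *)
pose w1 v := w v - cmul b1 (df i) v.
have hw1 v : ischain p.+1 (z - deg i v) (w1 v).
  by apply: ischainB; [exact: hw|exact: cmul_chain hb1].
have Pw1 v : cin (extX P) (w1 v) by apply: cinB => //; exact: cin_cmul.
have Qw1 v : cin (extX Q) (kd (w1 v)).
  have -> : kd (w1 v) = (kd (w v) - cmul y1 (df i) v)
      + cmul (fun u => y1 u - kd (b1 u) - cmul y3 (df i.+1) u) (df i) v.
    rewrite (cmulB (fun u => y1 u - kd (b1 u))) (cmulB y1) dfK subr0 addrA subrK.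
    by rewrite raddfB /= kd_cmul.
  by apply: cinD => //; exact: cin_cmul.
have H v : exists b, [/\ ischain p.+2 (z - deg i v) b,
  cin (extX P) b & cin (extX Q) (w1 v - kd b)].
  apply: (exact_extX idP idQ) => //.
  by apply: (ex 0%N); rewrite ?addn0.
have [b bP] := choice H.
exists b, b1; split=> [u|u|//|v]; try by case: (bP u).
by rewrite addrAC; case: (bP v).
Qed.

End Kunneth.

Section TensorExactness.
Variables (k : fieldType) (r s : nat).
Local Notation R := {mpoly k[r + s]}.
Local Notation eY := (@embY k r s).
Local Notation extX := (@extX k r s).
Local Notation extY := (@extY k r s).
Local Notation chain := {ffun {set 'I_(r + s)} -> {mpoly k[r + s]}}.
Variables (P Q : set {mpoly k[r]}) (J : set {mpoly k[s]}) (G : graded_free_resolution J).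
Hypotheses (idP : is_ideal P) (idQ : is_ideal Q) (QP : Q `<=` P).
Hypothesis stdG : standard G.

Definition ideal_add (S : comNzRingType) (I I' : set S) : set S :=
  [set x | exists a b, [/\ I a, I' b & x = a + b]].

Lemma is_ideal_add (S : comNzRingType) (I I' : set S) :
  is_ideal I -> is_ideal I' -> is_ideal (ideal_add I I').
Proof.
move=> idI idI'; split; first by exists 0, 0; split; rewrite ?addr0 //; exact: is_ideal0.
- move=> _ _ [a [b [Ia Ib ->]]] [a' [b' [Ia' Ib' ->]]].
  exists (a + a'), (b + b'); split; last by rewrite addrACA.
    exact: (is_idealD idI).
  exact: (is_idealD idI').
- move=> c _ [a [b [Ia Ib ->]]].
  exists (c * a), (c * b); split; last by rewrite mulrDr.
    exact: (is_idealM idI).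
  exact: (is_idealM idI').
Qed.

Let u0 := projT1 (cid stdG).
Let u0P u : u = u0. Proof. by rewrite /u0; case: cid => ? /= []. Qed.
Let aug0 : gfr_aug G u0 0 = 1. Proof. by rewrite /u0; case: cid => ? /= []. Qed.
Let deg0 : gfr_deg u0 = 0. Proof. by rewrite /u0; case: cid => ? /= []. Qed.

Let sum0 (S : nmodType) (F : 'I_(gfr_rank G 0) -> S) : \sum_u F u = F u0.
Proof. by rewrite (bigD1 u0) //= big1 ?addr0 // => u; rewrite (u0P u) eqxx. Qed.

Let idealE b : J b <-> exists g : 'rV_(gfr_rank G 1), b = (g *m gfr_diff G 0) 0 u0.
Proof.
have E (w : 'rV_(gfr_rank G 0)) : (w *m gfr_aug G) 0 0 = w 0 u0.
  by rewrite mxE sum0 aug0 mulr1.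
split=> [Jb|[g ->]].
  have [g gE] : exists g, (\row_u b : 'rV_(gfr_rank G 0)) = g *m gfr_diff G 0.
    by apply/(gfr_exact0 (g := G)); rewrite E mxE.
  by exists g; rewrite -gE mxE.
by rewrite -E; apply/(gfr_exact0 (g := G)); exists g.
Qed.

Lemma extY_diff b : extY J b <->
  exists w : 'I_(gfr_rank G 1) -> R, b = \sum_u w u * eY (gfr_diff G 0 u u0).
Proof.
split=> [Jb|[w ->]]; last first.
  apply: is_ideal_sum => [|u _]; first exact: is_ideal_extY.
  apply: (is_idealM (is_ideal_extY J)); apply: extY_embY; apply/idealE.
  by exists (delta_mx 0 u); rewrite -rowE mxE.
pose E : set R := [set b | exists w : 'I_(gfr_rank G 1) -> R,
  b = \sum_u w u * eY (gfr_diff G 0 u u0)].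
suff : extY J `<=` E by apply.
apply: ideal_span_le => [|_ [x /idealE [g ->] <-]].
  split; first by exists (fun=> 0); rewrite big1 // => u _; rewrite mul0r.
  - move=> _ _ [w ->] [w' ->]; exists (fun u => w u + w' u); rewrite -big_split.
    by apply: eq_bigr => u _; rewrite mulrDl.
  - move=> c _ [w ->]; exists (fun u => c * w u); rewrite mulr_sumr.
    by apply: eq_bigr => u _; rewrite mulrA.
exists (fun u => eY (g 0 u)); rewrite mxE (raddf_sum eY); apply: eq_bigr => u _ /=.
by rewrite rmorphM.
Qed.

(** Modulo P R the coefficients of the part of x in J R form a relation, hence by flatness of A/P a
    combination of syzygies; subtracting these moves the coefficients into P R. *)
Lemma extX_cap x : extX P x -> ideal_add (extX Q) (extY J) x ->
  exists w : 'I_(gfr_rank G 1) -> R, (forall u, extX P (w u)) /\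
    extX Q (x - \sum_u w u * eY (gfr_diff G 0 u u0)).
Proof.
move=> Px [a [b [Qa /extY_diff [w bE] xE]]].
have [|||w' [_ Pw']] := flatness (is_ideal_setT k r) idP (D := gfr_diff G 0) (D' :=
  gfr_diff G 1) (w := w).
- by move=> g /(gfr_exactS (g := G)).
- by move=> u; apply/(extXP (is_ideal_setT k r)).
- move=> v; rewrite (u0P v) -bE.
  have -> : b = x - a by rewrite xE addrAC subrr add0r.
  apply: is_idealB => //; first exact: is_ideal_extX.
  exact: extXS Qa.
exists (fun u => w u - \sum_v w' v * eY (gfr_diff G 1 v u)); split=> //.
suff -> : \sum_u (w u - \sum_v w' v * eY (gfr_diff G 1 v u)) * eY (gfr_diff G 0 u u0) = b.
  by rewrite xE addrK.
under eq_bigr do rewrite mulrBl.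
rewrite sumrB -bE [X in _ - X](_ : _ = 0) ?subr0 //.
under eq_bigr do rewrite mulr_suml.
rewrite exchange_big big1 // => v _ /=.
have := gfr_diffK G 0 => /matrixP/(_ v u0); rewrite !mxE => /(congr1 eY).
rewrite (raddf_sum eY) raddf0 => E.
apply: etrans (_ : w' v * (\sum_i eY (gfr_diff G 1 v i * gfr_diff G 0 i u0)) = 0);
  last first.
  by rewrite E mulr0.
by rewrite mulr_sumr; apply: eq_bigr => u _; rewrite rmorphM mulrA.
Qed.

(** This identifies the kernel of P R -> (P/Q) (x) (B/J), and brings in the product of ideals that
    lies in Q_n. *)
Lemma extX_capM x : extX P x -> ideal_add (extX Q) (extY J) x ->
  ideal_add (extX Q) (ideal_mul (extX P) (extY J)) x.
Proof.
move=> Px QJx; have [w [Pw Qxw]] := extX_cap Px QJx.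
exists (x - \sum_u w u * eY (gfr_diff G 0 u u0)), (\sum_u w u * eY (gfr_diff G 0 u u0)).
split; [exact: Qxw| |by rewrite subrK].
apply: is_ideal_sum => [|u _]; first exact: is_ideal_span.
apply: sub_ideal_span; exists (w u), (eY (gfr_diff G 0 u u0)); split=> //.
by apply: extY_embY; apply/idealE; exists (delta_mx 0 u); rewrite -rowE mxE.
Qed.

Hypotheses (homP : homogeneous_ideal P) (homQ : homogeneous_ideal Q).

(** [kunneth_shift] at i = 0: as G is standard, the cokernel of G_1 -> G_0 is B/J and the family has
    a single member. *)
Lemma exact_tensor p z :
  (forall q (u : 'I_(gfr_rank G q)), (q <= p)%N -> exact P Q (p - q) (z - gfr_deg u)) ->
  exact (extX P) (ideal_add (extX Q) (extY J)) p z.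
Proof.
move=> ex c cz Pc Qdc.
have H T : exists w : 'I_(gfr_rank G 1) -> R, (forall u, extX P (w u)) /\
    extX Q (kd c T - \sum_u w u * eY (gfr_diff G 0 u u0)).
  by apply: extX_cap => //; apply: cin_kd => //; exact: is_ideal_extX.
have [w wP] := choice H.
have [|||| b [y [hb Pb Py Qb]]] :=
  @kunneth_shift k r s P Q idP idQ J G homP homQ p 0 z (fun=> c).
- by move=> q l u qp lE; move: u; rewrite lE => u; exact: ex.
- by move=> u; rewrite (u0P u) deg0 subr0.
- by [].
- exists (fun u => [ffun T => w T u]) => [u T|v T]; first by rewrite ffunE; have [] := wP T.
  rewrite (u0P v) !ffunE; have := (wP T).2; congr (extX Q (_ - _)).
  by apply: eq_bigr => u _; rewrite ffunE mxE.
exists (b u0); split=> //; first by have := hb u0; rewrite deg0 subr0.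
move=> T; pose e := cmul y (map_mx eY (gfr_diff G 0)) u0.
exists ((c - kd (b u0) - e) T), (e T); split; first exact: Qb.
  apply/extY_diff; exists (fun u => y u T); rewrite ffunE.
  by apply: eq_bigr => u _; rewrite mxE.
have E (x y' : chain) : x T = (x - y') T + y' T by rewrite !ffunE subrK.
exact: E.
Qed.

End TensorExactness.

(** * Depth and regularity *)

Section Nonzerodivisors.
Variables (k : fieldType) (n : nat) (I : set {mpoly k[n]}).
Hypothesis idI : is_ideal I.
Local Notation R := {mpoly k[n]}.

Definition ann (a : R) : set R := [set x | I (x * a)].

(** These ideals [ann a] are the maximal associated primes of R/I; they allow prime avoidance
    without primary decomposition. *)
Definition maximal_ann a := ~ I a /\ forall b, ~ I b -> ann a `<=` ann b ->
  ann b `<=` ann a.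

Lemma is_ideal_ann a : is_ideal (ann a).
Proof.
split=> [|x y Ix Iy|c x Ix]; rewrite /ann /=; first by rewrite mul0r; exact: is_ideal0.
  by rewrite mulrDl; exact: is_idealD.
by rewrite -mulrA; exact: is_idealM.
Qed.

Lemma annM a y : ann a `<=` ann (y * a).
Proof. by move=> x Ix; rewrite /ann /= mulrCA; exact: is_idealM. Qed.

(** Otherwise there is a strictly increasing chain of annihilators, whose union is finitely
    generated and so already reached. *)
Lemma exists_maximal_ann a : ~ I a -> exists2 b, maximal_ann b & ann a `<=` ann b.
Proof.
move=> Ia; apply: contrapT => none.
have H b : exists b', ~ I b -> ann a `<=` ann b -> [/\ ~ I b',
  ann b `<=` ann b' & ~ ann b' `<=` ann b].
  have [[Ib ab]|] := pselect (~ I b /\ ann a `<=` ann b); last first.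
    by move=> nb; exists 0 => Ib ab; case: nb.
  apply: contrapT => nb'; apply: none; exists b => //; split=> // b' Ib' bb'.
  by apply: contrapT => b'b; apply: nb'; exists b'.
have [nxt nxtP] := choice H.
pose f i := iter i nxt a.
have fP i : ~ I (f i) /\ ann a `<=` ann (f i).
  elim: i => [|i [If af]]; first by split.
  have [If' ff' _] := nxtP _ If af; split=> //.
  exact: subset_trans af ff'.
have fS i : ann (f i) `<=` ann (f i.+1) by have [If af] := fP i; have [] := nxtP _ If af.
have fm i j : (i <= j)%N -> ann (f i) `<=` ann (f j).
  move=> /subnKC <-; elim: (j - i)%N => [|l IH]; first by rewrite addn0.
  by rewrite addnS; apply: subset_trans IH _; exact: fS.
pose L : set R := [set x | exists i, ann (f i) x].
have idL : is_ideal L.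
  split; first by exists 0%N; exact: is_ideal0 (is_ideal_ann _).
  - move=> x y [i xi] [j yj]; exists (maxn i j); apply: (is_idealD (is_ideal_ann _)).
      exact: fm (leq_maxl _ _) _ xi.
    exact: fm (leq_maxr _ _) _ yj.
  - by move=> c x [i xi]; exists i; exact: is_idealM (is_ideal_ann _) _ _ xi.
have [s [sL sP]] := hilbert_basis idL.
have [N NP] : exists N, forall x, x \in s -> ann (f N) x.
  elim: s sL {sP} => [|x s IH] sL; first by exists 0%N.
  have [|N NP] := IH; first by move=> y ys; apply: sL; rewrite inE ys orbT.
  have [i xi] := sL x (mem_head _ _).
  exists (maxn i N) => y; rewrite inE => /predU1P[->|/NP].
    exact: fm (leq_maxl _ _) _ xi.
  exact: fm (leq_maxr _ _) _.
have [If af] := fP N; have [_ _] := nxtP _ If af; apply => x xN.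
by apply: (sP _ (is_ideal_ann _) NP); exists N.+1.
Qed.

Lemma maximal_ann_prime a x y : maximal_ann a -> ~ I (x * a) -> ~ I (y * a) ->
  ~ I (x * y * a).
Proof.
move=> [Ia amax] Ix Iy Ixy; apply: Ix; apply: (amax (y * a)) => //; first exact: annM.
by rewrite /ann /= mulrA.
Qed.

(** Multiply elements of the various [ann j] outside [ann a]; the product stays outside because
    [ann a] is prime. *)
Lemma avoid_intersection a (l : seq R) : maximal_ann a ->
  (forall j, j \in l -> ~ (ann j `<=` ann a)) ->
  exists2 g, forall j, j \in l -> I (g * j) & ~ I (g * a).
Proof.
move=> amax; elim: l => [|j l IH] lP; first by exists 1; rewrite ?mul1r //; exact: amax.1.
have [|g gl ga] := IH; first by move=> i il; apply: lP; rewrite inE il orbT.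
have [y jy ay] : exists2 y, I (y * j) & ~ I (y * a).
  apply: contrapT => none; apply: (lP j (mem_head _ _)) => y jy.
  by apply: contrapT => ay; apply: none; exists y.
exists (y * g); last exact: maximal_ann_prime.
move=> i; rewrite inE => /predU1P[->|/gl gi].
  by rewrite mulrAC mulrC; exact: is_idealM.
by rewrite -mulrA; exact: is_idealM.
Qed.

(* The maximal annihilators ann(a) are finitely many: if a_1, ..., a_t generate
   the ideal of all such a, then some ann(a_i) is contained in ann(a). *)
Lemma finitely_many_maximal_ann : exists l : seq R, (forall a, a \in l -> maximal_ann a) /\
  forall a, maximal_ann a -> exists2 j, j \in l & ann j `<=` ann a.
Proof.
have [s [sL sP]] := hilbert_basis (is_ideal_span maximal_ann).
have [l [lM ls]] : exists l : seq R, (forall a, a \in l -> maximal_ann a) /\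
    forall x, x \in s -> ideal_span [set a | a \in l] x.
  elim: s sL {sP} => [|x s IH] sL; first by exists [::].
  have [|l [lM ls]] := IH; first by move=> y ys; apply: sL; rewrite inE ys orbT.
  have [t [tM xE]] := sL x (mem_head _ _).
  exists ([seq z.2 | z <- t] ++ l); split=> [a|y].
    by rewrite mem_cat => /orP[/mapP[z /tM zM ->] //|/lM].
  rewrite inE => /predU1P[->|/ls].
    exists t; split=> // z zt; rewrite /= mem_cat; apply/orP; left; exact: map_f.
  apply: ideal_span_le; first exact: is_ideal_span.
  by move=> b bl; apply: sub_ideal_span; rewrite /= mem_cat; apply/orP; right.
exists l; split=> // a aM; apply: contrapT => none.
(* Such a g kills every member of l modulo I, hence also a, which is a combination of them. *)
have [|g gl ga] := avoid_intersection (l := l) aM.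
  by move=> j jl ja; apply: none; exists j.
apply: ga.
have [t [tl ->]] : ideal_span [set a | a \in l] a.
  apply: (sP _ (is_ideal_span _) ls).
  exact: sub_ideal_span.
rewrite mulr_sumr big_seq; apply: is_ideal_sum => // z /tl zl.
by rewrite mulrCA; apply: (is_idealM idI); exact: gl.
Qed.

(** Prime avoidance: by the socle condition no maximal annihilator contains all variables, so f is
    built by adding, where needed, a term g X_i that avoids one annihilator and lies in the others
    already avoided. *)
Lemma exists_nonzerodivisor :
  (forall b, (forall i, I ('X_i * b)) -> I b) ->
  exists f : R, f@_0%MM = 0 /\ forall p, I (f * p) -> I p.
Proof.
move=> socle; have [l [lM lP]] := finitely_many_maximal_ann.
suff [f f0 fl] : exists2 f : R, f@_0%MM = 0 & forall j, j \in l -> ~ I (f * j).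
  exists f; split=> // p fp; apply: contrapT => Ip.
  have [a aM pa] := exists_maximal_ann Ip.
  have [j jl ja] := lP a aM.
  by apply: (fl j jl); apply: (lM j jl).2 ja _ _; [exact: aM.1|exact: pa].
elim: l lM {lP} => [|a l IH] lM; first by exists 0; rewrite ?mcoeff0.
have [|f f0 fl] := IH; first by move=> j jl; apply: lM; rewrite inE jl orbT.
have aM := lM a (mem_head _ _).
have [fa|fa] := pselect (I (f * a)); last first.
  by exists f => // j; rewrite inE => /predU1P[->|/fl].
(* If [ann j] were inside [ann a], maximality would make them equal, and f would kill j. *)
have [|g gl ga] := avoid_intersection (l := l) aM.
  move=> j jl ja; apply: (fl j jl).
  by apply: ((lM j _).2 a aM.1 ja); rewrite ?inE ?jl ?orbT.
have [i ia] : exists i, ~ I ('X_i * a).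
  apply: contrapT => none; apply: aM.1; apply: socle => i.
  by apply: contrapT => ia; apply: none; exists i.
have gia : ~ I (g * 'X_i * a) by exact: maximal_ann_prime.
exists (f + g * 'X_i); first by rewrite mcoeffD f0 rmorphM /= mcoeff0_X mulr0 addr0.
move=> j; rewrite inE => /predU1P[->|jl]; rewrite mulrDl => Ij.
  by apply: gia; rewrite -[_ * _ * a](addKr (f * a)); apply: is_idealD => //;
    exact: is_idealN.
apply: (fl j jl); rewrite -[f * j](addrK (g * 'X_i * j)); apply: is_idealB => //.
by rewrite mulrAC mulrC; apply: (is_idealM idI); exact: gl.
Qed.

End Nonzerodivisors.

(** * Regular sequences and vanishing of Koszul homology *)

Section RegularSequences.
Variables (k : fieldType) (n : nat).
Local Notation R := {mpoly k[n]}.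
Local Notation chain := {ffun {set 'I_n} -> {mpoly k[n]}}.
Implicit Types (I : set {mpoly k[n]}) (c b : chain).

Definition supp_in p c := forall T : {set 'I_n}, #|T| != p -> c T = 0.

(* The Koszul homology H_p(x_1, ..., x_n; R/I), without grading, vanishes. *)
Definition exactU I p := forall c, supp_in p c -> cin I (kd c) ->
  exists2 b, supp_in p.+1 b & cin I (c - kd b).

Lemma supp_in_big p c : (n < p)%N -> supp_in p c -> c = 0.
Proof.
move=> np c0; apply/ffunP=> T; rewrite [RHS]ffunE c0 // neq_ltn.
by rewrite (leq_ltn_trans (max_card _)) // card_ord.
Qed.

Lemma supp_inB p c b : supp_in p c -> supp_in p b -> supp_in p (c - b).
Proof. by move=> c0 b0 T Tp; rewrite !ffunE c0 // b0 // subr0. Qed.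

Lemma supp_in_con p i c : supp_in p.+1 c -> supp_in p (con i c).
Proof.
move=> c0 T Tp; rewrite ffunE; case: ifP => // iT.
by rewrite c0 ?mulr0 // cardsU1 iT add1n eqSS.
Qed.

Lemma supp_in_ext p i c : supp_in p c -> supp_in p.+1 (ext i c).
Proof.
move=> c0 T Tp; rewrite ffunE; case: ifP => // iT.
by rewrite c0 ?mulr0 //; apply: contra Tp => /eqP <-; rewrite [X in X == _](cardsD1 i) iT.
Qed.

Lemma supp_in_kd p c : supp_in p.+1 c -> supp_in p (kd c).
Proof.
move=> c0 T Tp; rewrite kdE big1 // => i _.
by rewrite (supp_in_con i c0) ?mulr0.
Qed.

Lemma supp_in_lmul p (x : R) c : supp_in p c -> supp_in p (cmap (lmul x) c).
Proof. by move=> c0 T Tp; rewrite ffunE c0 // /lmul mulr0. Qed.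

Lemma kd_lmul (x : R) c : kd (cmap (lmul x) c) = cmap (lmul x) (kd c).
Proof.
rewrite /kd raddf_sum; apply: eq_bigr => i _ /=; rewrite -cmap_con.
by apply/ffunP=> T; rewrite !ffunE /lmul mulrCA.
Qed.

Lemma const0_sum (f : R) : f@_0%MM = 0 -> exists F : 'I_n -> R, f = \sum_i F i * 'X_i.
Proof.
move=> f0; pose J : set R := [set f | exists F : 'I_n -> R, f = \sum_i F i * 'X_i].
have idJ : is_ideal J.
  split; first by exists (fun=> 0); rewrite big1 // => i _; rewrite mul0r.
  - move=> _ _ [F ->] [F' ->]; exists (fun i => F i + F' i); rewrite -big_split.
    by apply: eq_bigr => i _; rewrite mulrDl.
  - move=> c _ [F ->]; exists (fun i => c * F i); rewrite mulr_sumr.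
    by apply: eq_bigr => i _; rewrite mulrA.
suff : J f by [].
rewrite [f]mpolyE; apply: is_ideal_sum => // m _.
have [->|m0] := eqVneq m 0%MM; first by rewrite f0 scale0r; exact: is_ideal0.
have [i mi] : exists i, m i != 0%N.
  apply: contrapT => none; case/eqP: m0; apply/mnmP=> i; rewrite mnm0E.
  by apply: contrapT => /eqP mi; apply: none; exists i.
rewrite -mul_mpolyC -(submK (m' := m) (m := U_(i)%MM)) ?lep1mP // mpolyXD mulrA.
apply: (is_idealM idJ); exists (fun j => (j == i)%:R).
by rewrite (bigD1 i) //= eqxx mul1r big1 ?addr0 // => j /negbTE ->; rewrite mul0r.
Qed.

(** For f = sum of F_i X_i the homotopy is the exterior product by the sum of F_i e_i. *)
Lemma exists_homotopy (f : R) : f@_0%MM = 0 -> exists h : chain -> chain,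
  [/\ forall c, kd (h c) + h (kd c) = cmap (lmul f) c,
      forall p c, supp_in p c -> supp_in p.+1 (h c) &
      forall I c, is_ideal I -> cin I c -> cin I (h c)].
Proof.
move=> /const0_sum [F fE].
exists (fun c => \sum_i cmap (lmul (F i)) (ext i c)); split.
- move=> c; apply/ffunP=> T.
  have -> : kd (\sum_i cmap (lmul (F i)) (ext i c)) =
      \sum_i \sum_j cmap (lmul (F i * 'X_j)) (con j (ext i c)).
    rewrite raddf_sum; apply: eq_bigr => i _ /=; rewrite kd_lmul /kd raddf_sum.
    by apply: eq_bigr => j _ /=; apply/ffunP=> T'; rewrite !ffunE /lmul mulrA.
  have -> : \sum_i cmap (lmul (F i)) (ext i (kd c)) =
      \sum_i \sum_j cmap (lmul (F i * 'X_j)) (ext i (con j c)).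
    apply: eq_bigr => i _; rewrite /kd !raddf_sum; apply: eq_bigr => j _ /=.
    by rewrite -cmap_ext; apply/ffunP=> T'; rewrite !ffunE /lmul mulrA.
  rewrite -big_split /= (eq_bigr (fun i => cmap (lmul (F i * 'X_i)) c)) => [|i _].
    rewrite sum_ffunE ffunE /lmul fE mulr_suml; apply: eq_bigr => i _.
    by rewrite ffunE.
  rewrite -big_split (bigD1 i) //= big1 ?addr0 => [|j ji].
    by rewrite -raddfD /= con_ext_same.
  by rewrite -raddfD /= con_ext // addNr raddf0.
- move=> p c cp T Tp; rewrite sum_ffunE big1 // => i _.
  by apply: supp_in_lmul Tp; exact: supp_in_ext.
- move=> I c idI Ic T; rewrite sum_ffunE; apply: is_ideal_sum => // i _.
  by rewrite ffunE; apply: (is_idealM idI); exact: cin_ext.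
Qed.

Definition add_elt I (x : R) : set R := [set p | exists q, I (p - q * x)].

Lemma is_ideal_add_elt I x : is_ideal I -> is_ideal (add_elt I x).
Proof.
move=> idI; split; first by exists 0; rewrite mul0r subrr; exact: is_ideal0.
- move=> a b [q Iq] [q' Iq']; exists (q + q').
  by rewrite mulrDl opprD addrACA; exact: is_idealD.
- move=> c a [q Iq]; exists (c * q).
  by rewrite -mulrA -mulrBr; exact: is_idealM.
Qed.

Lemma cin_add_elt I x p c : is_ideal I -> supp_in p c -> cin (add_elt I x) c ->
  exists2 w, supp_in p w & cin I (c - cmap (lmul x) w).
Proof.
move=> idI cp /choice [w wP].
exists [ffun T : {set 'I_n} => if #|T| == p then w T else 0] => T.
  by rewrite ffunE => /negbTE ->.
rewrite !ffunE /lmul mulrC; case: ifPn => Tp; first exact: wP.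
by rewrite mul0r subr0 cp //; exact: is_ideal0.
Qed.

(** For a cycle c, the homotopy for x gives a cycle h c modulo I + (x), so h c is a boundary plus x
    w modulo I. Taking boundaries yields x c = x (kd w) modulo I, and x cancels. *)
Lemma regular_sequence_exactU xs I : is_ideal I ->
  (forall x, x \in xs -> x@_0%MM = 0) -> regular_sequence I xs ->
  forall p, (n < p + size xs)%N -> exactU I p.
Proof.
elim: xs I => [|x xs IH] I idI xs0 /=.
  move=> _ p; rewrite addn0 => np c cp _; rewrite (supp_in_big np cp).
  exists 0; first by move=> T _; rewrite ffunE.
  by rewrite raddf0 subr0; exact: cin0.
move=> [xreg reg] p np c cp Idc.
have [h [hE hp hI]] := exists_homotopy (xs0 x (mem_head _ _)).
have idI' := is_ideal_add_elt x idI.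
have dhE : kd (h c) = cmap (lmul x) c - h (kd c) by rewrite -hE addrK.
have I'dh : cin (add_elt I x) (kd (h c)).
  move=> T; exists (c T); rewrite dhE !ffunE /lmul mulrC addrAC subrr add0r.
  by apply: (is_idealN idI); exact: hI.
have [||e ep I'e] := IH (add_elt I x) idI' _ reg p.+1 _ (h c) (hp _ _ cp) I'dh.
- by move=> y yxs; apply: xs0; rewrite inE yxs orbT.
- by rewrite addSnnS.
have [w wp Iw] := cin_add_elt idI (supp_inB (hp _ _ cp) (supp_in_kd ep)) I'e.
exists w => // T; apply: xreg.
have : cin I (kd (h c - kd e - cmap (lmul x) w) + h (kd c)).
  by apply: cinD => //; [exact: cin_kd|exact: hI].
rewrite !raddfB /= kdd subr0 kd_lmul dhE.
have -> : cmap (lmul x) c - h (kd c) - cmap (lmul x) (kd w) + h (kd c)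
   = cmap (lmul x) (c - kd w) by rewrite raddfB /= addrAC subrK.
by move/(_ T); rewrite ffunE.
Qed.

(** H_n(R/I) is the socle of R/I, as there are no (n+1)-chains to bound anything. *)
Lemma exactU_socle I : is_ideal I -> exactU I n ->
  forall b : R, (forall i, I ('X_i * b)) -> I b.
Proof.
move=> idI ex b Ib.
pose c : chain := [ffun T : {set 'I_n} => if #|T| == n then b else 0].
have [||e ep Ie] := ex c.
- by move=> T /negbTE Tn; rewrite ffunE Tn.
- move=> T; rewrite kdE; apply: is_ideal_sum => // i _; rewrite !ffunE.
  case: ifP => _; first by rewrite mulr0; exact: is_ideal0.
  case: ifP => _; last by rewrite !mulr0; exact: is_ideal0.
  by rewrite mulrCA; exact: is_idealM.
have := Ie [set: 'I_n]%SET; rewrite (supp_in_big (ltnSn n) ep) raddf0 subr0.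
by rewrite ffunE cardsT card_ord eqxx.
Qed.

(** The socle is zero, so a nonzerodivisor f exists; H_p(R/(I + (f))) lies between H_p(R/I) and
    H_(p-1)(R/I), so passing to I + (f) costs one degree. *)
Lemma exactU_regular_sequence D I : is_ideal I -> (forall x, I x -> x@_0%MM = 0) ->
  (forall p, (n < p + D)%N -> exactU I p) ->
  exists xs : seq R, [/\ size xs = D, forall x, x \in xs ->
    x@_0%MM = 0 & regular_sequence I xs].
Proof.
elim: D I => [|D IH] I idI I0 ex.
  exists [::]; split=> // IT; have : I 1 by rewrite IT.
  by move/I0/eqP; rewrite mcoeff1 eqxx oner_eq0.
have [|f [f0 freg]] := exists_nonzerodivisor idI.
  by apply: exactU_socle => //; apply: ex; rewrite addnS ltnS leq_addr.
have idI' := is_ideal_add_elt f idI.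
have [||xs [xsD xs0 xsreg]] := IH (add_elt I f) idI'.
- move=> x [q /I0]; rewrite mcoeffB rmorphM /= f0 mulr0 subr0 //.
- move=> p np c cp I'dc; case: p np cp I'dc => [|p] np cp I'dc.
    have [||b bp Ib] := ex 0%N _ c cp.
    + by rewrite addnS (ltn_trans np).
    + by rewrite (kd_supp0 cp); exact: cin0.
    by exists b => // T; exists 0; rewrite mul0r subr0; exact: Ib.
  (* The boundary of c is f w modulo I. As f is regular, w is a cycle, so w bounds through some e,
     and c - f e is a cycle modulo I. *)
  have [w wp Iw] := cin_add_elt idI (supp_in_kd cp) I'dc.
  have Idw : cin I (kd w).
    move=> T; apply: freg; have := is_idealN idI (cin_kd idI Iw T).
    by rewrite raddfB /= kdd sub0r ffunE opprK kd_lmul ffunE.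
  have [|e ep Ie] := ex p _ w wp Idw; first by rewrite addnS -addSn.
  have Ice : cin I (kd (c - cmap (lmul f) e)).
    rewrite raddfB /= kd_lmul.
    have -> : kd c - cmap (lmul f) (kd e) = (kd c - cmap (lmul f) w) + cmap (lmul f) (w -
      kd e).
      by rewrite (raddfB (cmap (lmul f))) addrA subrK.
    apply: cinD => // T; rewrite ffunE; apply: (is_idealM idI); exact: Ie.
  have [||b bp Ib] := ex p.+1 _ _ _ Ice.
  - by rewrite addnS (ltn_trans np).
  - by apply: supp_inB => //; exact: supp_in_lmul.
  exists b => // T; exists (e T); have := Ib T.
  by rewrite !ffunE /lmul mulrC addrAC.
exists (f :: xs); split; first by rewrite /= xsD.
  by move=> x; rewrite inE => /predU1P[->|/xs0].
by split.
Qed.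

End RegularSequences.

(** * Depth and regularity as vanishing ranges *)

Section DepthRegularity.
Variables (k : fieldType) (n : nat).
Local Notation R := {mpoly k[n]}.
Local Notation chain := {ffun {set 'I_n} -> {mpoly k[n]}}.
Implicit Types (I : set {mpoly k[n]}) (c b : chain).

Lemma exactU_exact I p z : is_ideal I -> homogeneous_ideal I -> exactU I p ->
  exact setT I p z.
Proof.
move=> idI homI ex c cz _ Idc.
have [b _ Ib] := ex c ((ischainP p z c).1 cz).1 Idc.
exists (cprj p.+1 z b); split=> //; first exact: cprj_chain.
rewrite -cprj_kd -cz -raddfB; apply: cprj_in => // y x; exact: homogeneous_pih.
Qed.

Lemma exact_exactU I p : is_ideal I -> homogeneous_ideal I ->
  (forall z, exact setT I p z) -> exactU I p.
Proof.
move=> idI homI ex c cp Idc.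
pose N := \max_(T : {set 'I_n}) msize (c T).
(* N exceeds all degrees in c, so c is a finite sum of homogeneous chains, bounded separately. *)
have cE : c = \sum_(d < N) cprj p (d%:Z + p%:Z) c.
  apply/ffunP=> T; rewrite sum_ffunE.
  under eq_bigr do rewrite ffunE.
  case: (boolP (#|T| == p)) => [_|Tp]; last by rewrite cp // big1.
  under eq_bigr do rewrite addrK.
  exact: (pihomog_partitionE (leq_bigmax T)).
have H (d : 'I_N) : exists b, supp_in p.+1 b /\ cin I (cprj p (d%:Z + p%:Z) c - kd b).
  have [|||b [bz _ Ib]] := ex (d%:Z + p%:Z) (cprj p (d%:Z + p%:Z) c).
  - exact: cprj_chain.
  - by [].
  - rewrite cprj_kd0 //; apply: cprj_in => // y x; exact: homogeneous_pih.
  by exists b; split=> //; exact: ((ischainP _ _ b).1 bz).1.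
have [b bP] := choice H.
exists (\sum_d b d).
  by move=> T Tp; rewrite sum_ffunE big1 // => d _; exact: (bP d).1.
rewrite {1}cE (raddf_sum (@kd k n)) -sumrB => T; rewrite sum_ffunE.
by apply: is_ideal_sum => // d _; exact: (bP d).2.
Qed.

Lemma proper_const0 I : is_ideal I -> homogeneous_ideal I -> I <> setT ->
  forall x, I x -> x@_0%MM = 0.
Proof.
move=> idI homI IT x Ix; apply: contrapT => /eqP x0; apply: IT.
have : I (x@_0%MM)%:MP.
  have := homogeneous_pih 0 idI homI Ix; congr I; apply/mpolyP=> m.
  rewrite mcoeff_pih mcoeffC -[0 : int]/(0%:Z) eqz_nat mdeg_eq0.
  by case: eqVneq => [->|_]; rewrite ?mulr1 ?mulr0.
move=> Ic; apply/seteqP; split=> // y _.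
have -> : y = (y * ((x@_0%MM)^-1)%:MP) * (x@_0%MM)%:MP.
  by rewrite -mulrA -mpolyCM mulVf // mulr1.
exact: is_idealM.
Qed.

Lemma supremum_max (d : Order.disp_t) (T : orderType d) (x0 : T) (S : set T) x :
  S x -> ubound S x -> supremum x0 S = x.
Proof.
move=> Sx Ux; rewrite /supremum; case: ifPn => [/eqP S0|_]; first by move: Sx; rewrite S0.
have xs : supremums S x by split=> // y; apply.
by case: xgetP => [y _ ys|/(_ x)]; [exact: is_subset1_supremums ys xs|].
Qed.

Lemma depthP I : is_ideal I -> (forall x, I x -> x@_0%MM = 0) ->
  exists d : nat, [/\ depth I = (d%:Z%:E)%E,
    forall p, (n < p + d)%N -> exactU I p &
    forall D, (forall p, (n < p + D)%N -> exactU I p) -> (D <= d)%N].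
Proof.
move=> idI I0.
pose S := [set xs : seq R | (forall x, x \in xs -> x@_0%MM = 0) /\ regular_sequence I xs].
pose has_len t := `[< exists2 xs, S xs & size xs = t >].
(* A regular sequence of length over n would make H_0(R/I) vanish, although 1 is not a boundary
   modulo I. *)
have Sn t : has_len t -> (t <= n)%N.
  move/asboolP=> [xs [xs0 xsreg] <-]; rewrite leqNgt; apply/negP=> nxs.
  pose c : chain := [ffun T : {set 'I_n} => if #|T| == 0%N then 1 else 0].
  have cp : supp_in 0 c by move=> T /negbTE T0; rewrite ffunE T0.
  have [|b bp Ib] := regular_sequence_exactU idI xs0 xsreg (p := 0%N) nxs cp.
    by rewrite (kd_supp0 cp); exact: cin0.
  have := I0 _ (Ib finset.set0);
    rewrite !ffunE cards0 eqxx mcoeffB mcoeff0_kd subr0 mcoeff1 eqxx.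
  by move/eqP; rewrite oner_eq0.
have ex0 : exists t, has_len t.
  exists 0%N; apply/asboolP; exists [::] => //; split=> //= IT.
  have /I0/eqP : I 1 by rewrite IT.
  by rewrite mcoeff1 eqxx oner_eq0.
have [d /asboolP[xs Sxs xsd] dmax] := ex_maxnP ex0 Sn.
exists d; split.
- apply: supremum_max; first by exists xs; rewrite ?xsd.
  move=> _ [ys Sys <-]; rewrite lee_fin lez_nat; apply: dmax.
  by apply/asboolP; exists ys.
- by move=> p np; apply: (regular_sequence_exactU idI Sxs.1 Sxs.2); rewrite xsd.
- move=> D /(exactU_regular_sequence idI I0) [ys [ysD ys0 ysreg]].
  by apply: dmax; apply/asboolP; exists ys.
Qed.

(** In both default cases [supremum] returns -oo, so no least upper bound has to be produced
    here. *)
Lemma supremum_le (S : set \bar int) V : ubound S V -> (supremum -oo%E S <= V)%E.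
Proof.
move=> UV; rewrite /supremum; case: ifPn => _; first exact: leNye.
by case: xgetP => [y _ [_ ly]|_]; [exact: ly|exact: leNye].
Qed.

(** Needed because [supremum] falls back to -oo where no least upper bound exists. A set of integers
    bounded by N has a maximum N - m with m least; an unbounded one has +oo. *)
Lemma int_supremums_neq0 (S : set \bar int) t :
  (forall x, S x -> exists a : int, x = a%:E) -> S t -> supremums S !=set0.
Proof.
move=> Sfin St; have [a ta] := Sfin t St.
have [[N SN]|unb] := pselect (exists N : int, ubound S N%:E); last first.
  exists +oo%E; split=> [x _|y Uy]; first exact: leey.
  case: y Uy => [b Ub| |Ub]; [by case: unb; exists b|by []|].
  by have := Ub t St; rewrite ta.
have ex : exists m : nat, `[< S ((N - m%:Z)%:E) >].
  have aN : a <= N by have := SN t St; rewrite ta lee_fin.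
  exists `|N - a|%N; apply/asboolP.
  by rewrite gez0_abs ?subr_ge0 // subKr -ta.
have [m /asboolP Sm mmin] := ex_minnP ex.
exists (N - m%:Z)%:E; split=> [x Sx|y]; last by apply.
have [b xb] := Sfin x Sx; have bN : b <= N by have := SN x Sx; rewrite xb lee_fin.
rewrite xb lee_fin lerBrDr -lerBrDl.
have -> : N - b = `|N - b|%N%:Z by rewrite gez0_abs ?subr_ge0.
rewrite lez_nat; apply: mmin; apply/asboolP.
by rewrite gez0_abs ?subr_ge0 // subKr -xb.
Qed.

Lemma reg_ge I (F : graded_free_resolution I) i (u : 'I_(gfr_rank F i)) :
  minimal_resolution F -> ((gfr_deg u - i%:Z)%:E <= reg I)%E.
Proof.
move=> minF; have Su : [set x | exists (F : graded_free_resolution I) (i : nat)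
    (u : 'I_(gfr_rank F i)), minimal_resolution F /\
      x = (gfr_deg u - i%:Z)%:E] (gfr_deg u - i%:Z)%:E.
  by exists F, i, u.
apply: ge_supremum_Nmem => //; apply: int_supremums_neq0 Su.
by move=> x [F' [i' [u' [_ ->]]]]; exists (gfr_deg u' - i'%:Z).
Qed.

Lemma reg_le I (V : \bar int) :
  (forall (F : graded_free_resolution I) i (u : 'I_(gfr_rank F i)),
    minimal_resolution F -> ((gfr_deg u - i%:Z)%:E <= V)%E) -> (reg I <= V)%E.
Proof.
by move=> FV; apply: supremum_le => x [F [i [u [minF ->]]]]; exact: FV.
Qed.

Lemma embY0 (p : R) : @embY k 0 n p = p.
Proof.
rewrite /embY -[RHS]comp_mpoly_id; congr (_ \mPo _).
Qed.

(* The Koszul homology of R/I is computed by any resolution of R/I: this is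
   [exact_tensor] for the ring k[X] without variables and M = k. *)
Lemma resolution_exact I (F : graded_free_resolution I) p z :
  is_ideal I -> standard F -> (forall u : 'I_(gfr_rank F p), gfr_deg u <> z) ->
  exact setT I p z.
Proof.
move=> idI stdF Fz.
have hom0 : homogeneous_ideal ([set 0] : set {mpoly k[0]}) by move=> x d ->;
  rewrite /= raddf0.
have homT : homogeneous_ideal (setT : set {mpoly k[0]}) by [].
have ex := @exact_tensor k 0 n setT [set 0] I F (is_ideal_setT k 0) (is_ideal_zero k 0)
  (fun _ _ => Logic.I) stdF homT hom0 p z.
have {}ex : exact (@extX k 0 n setT) (ideal_add (@extX k 0 n [set 0]) (@extY k 0 n I)) p z.
  (* Over k only bidegree (0, 0) carries homology: the one obstruction is q = p with a basis element
     of degree z, which [Fz] excludes. *)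
  apply: ex => q u qp; apply: koszul_acyclic; rewrite subn_eq0 -ltnNge subr_eq0 eq_sym.
  have [//|pq] := ltnP q p; have E : q = p by apply/eqP; rewrite eqn_leq qp pq.
  by move: u; rewrite E => u; apply/eqP/Fz.
have ET : @extX k 0 n setT = setT.
  apply/seteqP; split=> // x _; apply/(extXP (is_ideal_setT k 0)) => m //.
have E0 : @extX k 0 n [set 0] = [set 0].
  apply/seteqP; split=> [x|_ ->]; last exact: is_ideal0 (is_ideal_extX _).
  by apply: (ideal_span_le (is_ideal_zero _ _)) => _ [_ -> <-]; rewrite /= raddf0.
have EI : @extY k 0 n I = I.
  apply/seteqP; split=> [|x Ix]; last by rewrite -[x]embY0; exact: extY_embY.
  by apply: (ideal_span_le idI) => _ [y Iy <-]; rewrite embY0.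
have EA : ideal_add [set 0] I = I.
  apply/seteqP; split=> [_ [_ [b [-> Ib ->]]]|x Ix]; first by rewrite add0r.
  by exists 0, x; rewrite add0r.
by move: ex; rewrite ET E0 EI EA.
Qed.

End DepthRegularity.

(** * The filtration of R / Q_n *)

Section SumFiltration.
Variables (k : fieldType) (r s : nat).
Variables (I : nat -> set {mpoly k[r]}) (J : nat -> set {mpoly k[s]}).
Hypotheses (filtI : filtration I) (homI : forall i, homogeneous_ideal (I i)).
Hypotheses (filtJ : filtration J) (homJ : forall j, homogeneous_ideal (J j)).
Variables (n : nat) (n_gt0 : (0 < n)%N).
Local Notation R := {mpoly k[r + s]}.
Local Notation extX := (@extX k r s).
Local Notation extY := (@extY k r s).
Local Notation Q := (sum_filtration I J n).

Lemma filtration_le (S : comNzRingType) (P : nat -> set S) i j :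
  filtration P -> (i <= j)%N -> P j `<=` P i.
Proof.
move=> filtP /subnKC <-; elim: (j - i)%N => [|l IH]; first by rewrite addn0.
by rewrite addnS => x /(filtration_decr filtP); exact: IH.
Qed.

Lemma filtration_const0 m (P : nat -> set {mpoly k[m]}) i : filtration P ->
  (forall i, homogeneous_ideal (P i)) -> (0 < i)%N -> forall x, P i x -> x@_0%MM = 0.
Proof.
move=> filtP homP i0 x /(filtration_le filtP i0).
apply: proper_const0; [exact: filtration_ideal|exact: homP|].
exact: filtration1_proper filtP.
Qed.

Let idI i : is_ideal (I i). Proof. exact: filtration_ideal. Qed.
Let idJ j : is_ideal (J j). Proof. exact: filtration_ideal. Qed.

Lemma is_ideal_sum_filtration : is_ideal Q. Proof. exact: is_ideal_span. Qed.
Let idQ := is_ideal_sum_filtration.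

Lemma mul_sum_filtration i j : (i + j)%N = n -> ideal_mul (extX (I i)) (extY (J j)) `<=` Q.
Proof. by move=> ij x xIJ; apply: sub_ideal_span; exists i, j. Qed.

(** In a product I_a J_b with a + b = n, either a > i, or a <= i and then b >= n - i. *)
Lemma sum_filtration_le i : (i < n)%N ->
  Q `<=` ideal_add (extX (I i.+1)) (extY (J (n - i))).
Proof.
move=> ni; have idA : is_ideal (ideal_add (extX (I i.+1)) (extY (J (n - i)))).
  by apply: is_ideal_add; exact: is_ideal_span.
apply: ideal_span_le => // x0 [a [b [ab x0ab]]]; move: x0 x0ab; apply: ideal_span_le => //.
move=> _ [x [y [Ix Jy ->]]].
have [ia|ai] := ltnP i a.
  exists (x * y), 0; split; rewrite ?addr0 //; last exact: is_ideal0 (is_ideal_extY _).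
  rewrite mulrC; apply: (is_idealM (is_ideal_extX _)).
  exact: extXS (filtration_le filtI ia) _ Ix.
exists 0, (x * y); split; rewrite ?add0r //; first exact: is_ideal0 (is_ideal_extX _).
apply: (is_idealM (is_ideal_extY _)).
apply: extYS (filtration_le filtJ _) _ Jy.
by rewrite -ab leq_subLR leq_add2r.
Qed.

Lemma pih_sum_filtration z x : Q x -> Q (pih z x).
Proof.
apply: pih_span => d {}x [a [b [ab xab]]]; apply: sub_ideal_span; exists a, b; split=> //.
move: xab; apply: pih_span => {}d _ [u [v [Iu Jv ->]]].
rewrite [u]pihom_sum mulr_suml raddf_sum.
apply: is_ideal_sum => [|e _ /=]; first exact: is_ideal_span.
rewrite (pihM _ _ (@pihP _ _ _ _)); apply: sub_ideal_span.
exists (pih e%:Z u), (pih (d - e%:Z) v); split=> //.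
  by apply: pih_extX Iu => y c; exact: homogeneous_pih.
by apply: pih_extY Jv => y c; exact: homogeneous_pih.
Qed.

Lemma homogeneous_sum_filtration : homogeneous_ideal Q.
Proof. by move=> x d; exact: (@pih_sum_filtration d%:Z). Qed.

Lemma mcoeff0_embX a : (@embX k r s a)@_0%MM = a@_0%MM.
Proof.
apply: (mpoly_rmorph_eq (f := mcoeff 0%MM \o @embX k r s) (g := mcoeff 0%MM)) => [c|i] /=.
  by rewrite embXC !mcoeffC !eqxx.
by rewrite embX_X !mcoeff0_X.
Qed.

Lemma mcoeff0_embY a : (@embY k r s a)@_0%MM = a@_0%MM.
Proof.
apply: (mpoly_rmorph_eq (f := mcoeff 0%MM \o @embY k r s) (g := mcoeff 0%MM)) => [c|i] /=.
  by rewrite embYC !mcoeffC !eqxx.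
by rewrite embY_X !mcoeff0_X.
Qed.

Lemma sum_filtration_const0 x : Q x -> x@_0%MM = 0.
Proof.
pose m0 : set R := [set x | x@_0%MM = 0].
have idm : is_ideal m0.
  split=> [|a b a0 b0|a b b0]; rewrite /m0 /=; first exact: mcoeff0.
    by rewrite mcoeffD a0 b0 addr0.
  by rewrite rmorphM /= b0 mulr0.
(* The case i = 0: Q lies in I_1 R + J_n R. *)
move/(sum_filtration_le n_gt0) => [a [b [Ia Jb ->]]].
apply: (is_idealD idm).
  apply: (ideal_span_le idm) Ia => _ [y Iy <-]; rewrite /m0 /= mcoeff0_embX.
  exact: (filtration_const0 filtI homI _ Iy).
apply: (ideal_span_le idm) Jb => _ [y Jy <-]; rewrite /m0 /= mcoeff0_embY.
by apply: (filtration_const0 filtJ homJ _ Jy); rewrite subn0.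
Qed.

(* U_i / U_(i+1) = (I_i / I_(i+1)) (x) (B / J_(n-i)) for U_i = I_i R + Q_n. *)
Lemma exact_step i (G : graded_free_resolution (J (n - i))) p z : (i < n)%N -> standard G ->
  (forall q (u : 'I_(gfr_rank G q)), (q <= p)%N ->
     exact (I i) (I i.+1) (p - q) (z - gfr_deg u)) ->
  exact (ideal_add (extX (I i)) Q) (ideal_add (extX (I i.+1)) Q) p z.
Proof.
move=> ni stdG ex c cz Uc Udc.
have idx j : is_ideal (extX (I j)) by exact: is_ideal_extX.
have subU : ideal_add (extX (I i.+1)) Q `<=` ideal_add (extX (I i.+1)) (extY (J (n - i))).
  have idA : is_ideal (ideal_add (extX (I i.+1)) (extY (J (n - i)))).
    by apply: is_ideal_add; exact: is_ideal_span.
  move=> _ [a [b [Ia Qb ->]]]; apply: (is_idealD idA); last exact: sum_filtration_le Qb.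
  by exists a, 0; rewrite addr0; split=> //; exact: is_ideal0 (is_ideal_extY _).
have H T : exists a, extX (I i) a /\ Q (c T - a).
  by have [a [b [Ia Qb ->]]] := Uc T; exists a; rewrite addrAC subrr add0r.
have [f fP] := choice H.
pose c0 : {ffun {set 'I_(r + s)} -> R} := [ffun T => f T].
(* Modulo Q the chain c is replaced by a homogeneous one with coefficients in I_i R, to which
   [exact_tensor] applies. *)
pose c1 := cprj p z c0.
have Ic1 : cin (extX (I i)) c1.
  apply: cprj_in => // [y x|T]; last by rewrite ffunE; exact: (fP T).1.
  by apply: pih_extX => y' d; exact: homogeneous_pih.
have Qc1 : cin Q (c - c1).
  rewrite -[c in c - _]cz -raddfB; apply: cprj_in => // [y x|T];
    first exact: pih_sum_filtration.
  by rewrite !ffunE; exact: (fP T).2.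
have idU : is_ideal (ideal_add (extX (I i.+1)) Q) by exact: is_ideal_add.
have QU : Q `<=` ideal_add (extX (I i.+1)) Q.
  by move=> x Qx; exists 0, x; rewrite add0r; split=> //; exact: is_ideal0.
have Udc1 : cin (ideal_add (extX (I i.+1)) Q) (kd c1).
  rewrite -[c1](subKr c) raddfB; apply: cinB => //.
  by apply: cinS QU _; exact: cin_kd.
have sub : I i.+1 `<=` I i by exact: filtration_decr.
have [b [bz Ib Eb]] := exact_tensor (idI i) (idI i.+1) sub stdG (@homI i) (@homI i.+1) ex
   (cprj_chain p z c0) Ic1 (cinS subU Udc1).
exists b; split=> //.
  move=> T; exists (b T), 0; rewrite addr0; split=> //; exact: is_ideal0.
have -> : c - kd b = (c - c1) + (c1 - kd b) by rewrite addrA subrK.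
apply: cinD => //; first exact: cinS QU _.
move=> T; have Ie : extX (I i) ((c1 - kd b) T) by apply: cinB => //; exact: cin_kd.
(* The remainder is only known modulo J_(n-i) R; lying in I_i R too, its part there can be taken in
   I_i J_(n-i), inside Q. *)
have [a [e [Ia Qe ->]]] := extX_capM (idI i) sub stdG Ie (Eb T).
exists a, e; split=> //.
by apply: mul_sum_filtration Qe; rewrite subnKC // ltnW.
Qed.

Lemma exact_sum_filtration p z :
  (forall i, (i < n)%N -> exists G : graded_free_resolution (J (n - i)), standard G /\
    forall q (u : 'I_(gfr_rank G q)), (q <= p)%N ->
      exact (I i) (I i.+1) (p - q) (z - gfr_deg u)) ->
  exact setT Q p z.
Proof.
move=> H; pose U i := ideal_add (extX (I i)) Q.
have idU i : is_ideal (U i) by apply: is_ideal_add => //; exact: is_ideal_extX.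
have U0 : U 0%N = setT.
  apply/seteqP; split=> // x _; exists x, 0; rewrite addr0; split=> //;
    last exact: is_ideal0.
  by rewrite (filtration0 filtI); apply/(extXP (is_ideal_setT k r)).
have Un : U n = Q.
  apply/seteqP; split=> [_ [a [b [Ia Qb ->]]]|x Qx]; last first.
    by exists 0, x; rewrite add0r; split=> //; exact: is_ideal0 (is_ideal_extX _).
  apply: (is_idealD idQ) => //; apply: (mul_sum_filtration (addn0 n)).
  apply: sub_ideal_span; exists a, 1; split; rewrite ?mulr1 //.
  have -> : 1 = @embY k r s 1 by rewrite rmorph1.
  by apply: extY_embY; rewrite (filtration0 filtJ).
have US i : U i.+1 `<=` U i.
  move=> _ [a [b [Ia Qb ->]]]; exists a, b; split=> //.
  exact: extXS (@filtration_decr _ _ filtI i) _ Ia.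
rewrite -Un; move: (leqnn n); elim: {1 3}n => [|i IH] ni.
  by rewrite U0 => c cz _ _; exists 0; split=> //; rewrite /ischain raddf0.
have [G [stdG Gex]] := H i ni.
apply: (exact_extension (idU i) (idU i.+1) (is_ideal_setT k (r + s)) (US i)) => //.
  exact: exact_step Gex.
exact: IH (ltnW ni).
Qed.

Lemma standard_resolution_J i : (i < n)%N ->
  exists G : graded_free_resolution (J (n - i)), minimal_resolution G /\ standard G.
Proof.
move=> ni; apply: standard_minimal_resolution => //.
by apply: filtration_const0 => //; rewrite subn_gt0.
Qed.

(* [exact_kernel] for I_i / I_(i+1), the kernel of A/I_(i+1) -> A/I_i. *)
Lemma exact_quotient i p z : exact setT (I i.+1) p z ->
  ((0 < i)%N -> exact setT (I i) p.+1 z) -> exact (I i) (I i.+1) p z.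
Proof.
(* For i = 0 the module is A/I_1 itself. *)
move=> exS; case: i exS => [|i] exS exi; first by rewrite (filtration0 filtI).
apply: (exact_kernel _ _ (is_ideal_setT k r)) (exi isT) => //.
exact: filtration_decr.
Qed.

Lemma bigmine_le (a b : nat) (F : nat -> \bar int) j : (a <= j < b)%N ->
  (\big[mine/+oo]_(a <= i < b) F i <= F j)%E.
Proof.
move=> ajb; rewrite (big_rem j) ?mem_index_iota //=.
by rewrite ge_min lexx.
Qed.

Lemma bigmaxe_ge (a b : nat) (F : nat -> \bar int) j : (a <= j < b)%N ->
  (F j <= \big[maxe/-oo]_(a <= i < b) F i)%E.
Proof.
move=> ajb; rewrite (big_rem j) ?mem_index_iota //=.
by rewrite le_max lexx.
Qed.

Lemma depth_sum_filtration :
  (mine (\big[mine/+oo]_(1 <= i < n) (depth (I (n - i)%N) + depth (J i) + 1))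
        (\big[mine/+oo]_(1 <= j < n.+1)
           (depth (I (n - j + 1)%N) + depth (J j)))
     <= depth Q)%E.
Proof.
have [d [dQ _ dmax]] := depthP idQ sum_filtration_const0.
rewrite dQ leNgt lt_min; apply/negP=> /andP[lt1 lt2].
(* If d were below the bound, homology would vanish in the range belonging to d + 1, against the
   maximality of d. *)
have : (d.+1 <= d)%N; last by rewrite ltnn.
apply: dmax => p np; apply: exact_exactU => //; first exact: homogeneous_sum_filtration.
move=> z; apply: exact_sum_filtration => i ni.
have [G [minG stdG]] := standard_resolution_J ni; exists G; split=> // q u qp.
have J0 : forall x, J (n - i) x -> x@_0%MM = 0.
  by apply: filtration_const0 => //; rewrite subn_gt0.
have [b [bJ exJ _]] := depthP (idJ (n - i)) J0.
(* The resolution of B/J_(n-i) has length at most s - b, since homology above that degree vanishes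
   and forbids basis elements. *)
have qb : (q + b <= s)%N.
  rewrite leqNgt; apply/negP=> sqb; apply: (betti_degree (idJ _) (@homJ _) (u :=
    u) minG _ erefl).
  by apply: exactU_exact => //; exact: exJ.
have [a1 [a1I exI1 _]] := depthP (idI i.+1) (filtration_const0 filtI homI (ltn0Sn i)).
(* The term j = n - i of the second form, as n - j + 1 = i + 1. *)
have ab1 : (d < a1 + b)%N.
  have := @bigmine_le 1 n.+1 (fun j => (depth (I (n - j + 1)%N) + depth (J j))%E) (n - i).
  rewrite subn_gt0 ni ltnS leq_subr => /(_ isT) /(lt_le_trans lt2).
  by rewrite (subKn (ltnW ni)) addn1 a1I bJ -EFinD lte_fin -PoszD ltz_nat.
apply: exact_quotient => [|i0]; apply: exactU_exact => //.
  by apply: exI1; rewrite -(ltn_add2r (q + b)%N); lia.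
have [a [aI exI _]] := depthP (idI i) (filtration_const0 filtI homI i0).
(* The term of index n - i of the first form, in range because 0 < i. Its extra 1 weakens the
   inequality, which suffices since vanishing is needed one degree higher. *)
have ab : (d <= a + b)%N.
  have := @bigmine_le 1 n (fun j => (depth (I (n - j)%N) + depth (J j) + 1)%E) (n - i).
  rewrite subn_gt0 ni /= ltn_subrL i0 n_gt0 => /(_ isT) /(lt_le_trans lt1).
  by rewrite (subKn (ltnW ni)) aI bJ -!EFinD lte_fin -!PoszD ltz_nat addn1 ltnS.
by apply: exI; lia.
Qed.

Lemma reg_exact m (P : set {mpoly k[m]}) (a : int) p z :
  is_ideal P -> homogeneous_ideal P -> (forall x, P x -> x@_0%MM = 0) ->
  reg P = a%:E -> a < z - p%:Z -> exact setT P p z.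
Proof.
move=> idP homP P0 Pa az.
have [F [minF stdF]] := standard_minimal_resolution idP homP P0.
apply: (resolution_exact idP stdF) => u uz.
by have := reg_ge u minF; rewrite Pa lee_fin uz leNgt az.
Qed.

(** The basis element of degree 0 in F_0 contributes 0. This rules out -oo, which could absorb +oo
    in the sums of regularities. *)
Lemma reg_ge0 m (P : set {mpoly k[m]}) :
  is_ideal P -> homogeneous_ideal P -> (forall x, P x -> x@_0%MM = 0) -> (0 <= reg P)%E.
Proof.
move=> idP homP P0; have [F [minF [u0 [_ _ u00]]]] :=
  standard_minimal_resolution idP homP P0.
by have := reg_ge u0 minF; rewrite u00 subrr.
Qed.

Lemma reg_sum_filtration :
  (reg Q
     <= maxe (\big[maxe/-oo]_(1 <= i < n) (reg (I (n - i)%N) + reg (J i) + 1))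
             (\big[maxe/-oo]_(1 <= j < n.+1)
                (reg (I (n - j + 1)%N) + reg (J j))))%E.
Proof.
apply: reg_le => F l v minF; rewrite leNgt gt_max; apply/negP=> /andP[lt1 lt2].
(* A basis element of F_l in degree z with z - l above the bound is refuted by vanishing of H_l(R/Q)
   in degree z. *)
apply: (betti_degree idQ homogeneous_sum_filtration (u := v) minF _ erefl).
set z := gfr_deg v in lt1 lt2 *.
apply: exact_sum_filtration => i ni.
have [G [minG stdG]] := standard_resolution_J ni; exists G; split=> // q u qp.
have J0 : forall x, J (n - i) x -> x@_0%MM = 0.
  by apply: filtration_const0 => //; rewrite subn_gt0.
have I10 := filtration_const0 filtI homI (ltn0Sn i).
have := reg_ge u minG; have := reg_ge0 (idJ (n - i)) (@homJ _) J0.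
have := reg_ge0 (idI i.+1) (@homI _) I10.
have lt2' : (reg (I i.+1) + reg (J (n - i)) < (z - l%:Z)%:E)%E.
  apply: le_lt_trans lt2; have := @bigmaxe_ge 1 n.+1 (fun j =>
    (reg (I (n - j + 1)%N) + reg (J j))%E) (n - i).
  by rewrite (subKn (ltnW ni)) addn1; apply; rewrite subn_gt0 ni ltnS leq_subr.
have lt1' : (0 < i)%N -> (reg (I i) + reg (J (n - i)) + 1 < (z - l%:Z)%:E)%E.
  move=> i0; apply: le_lt_trans lt1; have := @bigmaxe_ge 1 n (fun j =>
    (reg (I (n - j)%N) + reg (J j) + 1)%E) (n - i).
  by rewrite (subKn (ltnW ni)); apply; rewrite subn_gt0 ni /= ltn_subrL i0 n_gt0.
(* All regularities are finite: -oo contradicts [reg_ge0], and +oo the strict bounds. *)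
case: (reg (J (n - i))) lt1' lt2' => [b| |] lt1' lt2' //; last by case: (reg (I i.+1)) lt2'.
case E1 : (reg (I i.+1)) lt2' => [a1| |] // lt2' _ _; rewrite !(lee_fin,
  lte_fin) in lt2' * => ub.
(* As deg u - q <= b, removing u from the bidegree (l, z) lowers z - l by at most b, which leaves
   more than reg I_(i+1), or more than reg I_i + 1. *)
apply: exact_quotient => [|i0].
  by apply: (reg_exact (idI _) (@homI _) I10 E1); lia.
have I0 := filtration_const0 filtI homI i0.
have := reg_ge0 (idI i) (@homI _) I0; have := lt1' i0.
case E : (reg (I i)) => [a| |] // {}lt1' _; rewrite !(lee_fin, lte_fin) in lt1'.
by apply: (reg_exact (idI _) (@homI _) I0 E); lia.
Qed.

End SumFiltration.

Theorem theorem4p2 (k : fieldType) (r s : nat)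
    (I : nat -> set {mpoly k[r]}) (J : nat -> set {mpoly k[s]})
    (filtI : filtration I) (homI : forall i, homogeneous_ideal (I i))
    (filtJ : filtration J) (homJ : forall j, homogeneous_ideal (J j))
    (n : nat) (n_ge1 : (1 <= n)%N) :
  (mine (\big[mine/+oo]_(1 <= i < n) (depth (I (n - i)%N) + depth (J i) + 1))
        (\big[mine/+oo]_(1 <= j < n.+1)
           (depth (I (n - j + 1)%N) + depth (J j)))
     <= depth (sum_filtration I J n))%E
  /\
  (reg (sum_filtration I J n)
     <= maxe (\big[maxe/-oo]_(1 <= i < n) (reg (I (n - i)%N) + reg (J i) + 1))
             (\big[maxe/-oo]_(1 <= j < n.+1)
                (reg (I (n - j + 1)%N) + reg (J j))))%E.
Proof.
split; first exact: depth_sum_filtration.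
exact: reg_sum_filtration.
Qed.
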